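(* Let $f=(f(u,v),\ u\ge 0,\ v\in\mathbb{R})$ be a real-valued function of two variables. For a class $\mathcal V$ of continuous semimartingales vanishing at $0$, say that $f$ is a solution of the functional equation with domain of validity $\mathcal V$ if for all $X,Y\in\mathcal V$ and each $t\ge 0$ $$f(\langle X\rangle_t, X_t)\,f(\langle Y\rangle_t, Y_t)=f(\langle X+Y\rangle_t,\ X_t+Y_t+\langle X,Y\rangle_t)\qquad P\text{-a.s.}$$ (1) The following assertions are equivalent: a) $f$ is a continuous strictly positive solution of the functional equation with domain of validity $\mathcal V=\mathcal S$. b) $f$ is a continuous strictly positive solution of the functional equation with domain of validity $\mathcal V=\mathcal M^W(I)$. c) There is a constant $c\in\mathbb{R}$ such that $f(u,v)=e^{cv-\frac{c}{2}u}$ for all $u\ge 0$, $v\in\mathbb{R}$. (2) If one considers only measurable solutions, the following two conditions are equivalent: b') $f$ is a measurable strictly positive solution of the functional equation with domain of validity $\mathcal V=\mathcal M^W(I)$. c') There is a constant $c\in\mathbb{R}$ such that $f(u,v)$ coincides with $e^{cv-\frac{c}{2}u}$ almost everywhere with respect to the Lebesgue measure on $\mathbb{R}_+\times\mathbb{R}$.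
   Context: $(\Omega,\mathcal F,P)$ is a complete probability space with a filtration $(\mathcal F_t)_{t\ge 0}$ satisfying the usual conditions of right-continuity and completeness, and $W=(W_t)_{t\ge0}$ is a standard Brownian motion with respect to this filtration. $\mathcal S$ is the class of continuous semimartingales $X$ (with respect to $(\mathcal F_t)$) with $X_0=0$. For $X,Y\in\mathcal S$, $\langle X\rangle$ is the square characteristic (quadratic variation) of the martingale part of $X$, and $\langle X,Y\rangle$ is the mutual characteristic (quadratic covariation) of $X$ and $Y$. $\mathcal M^W(I)$ is the class of stochastic integrals $h\cdot W=\int_0^{\cdot}h_u\,dW_u$ with deterministic integrands of the form $h_u=I_{[a\le u\le b]}$, where $0\le a\le b$.
   Formalization: In (2), c')⇒b') is stated for a version of f: c') holds iff f equals Lebesgue-a.e. some g satisfying b'); literally it fails, e.g. for f=1 except f(0,0)=2 (take t=0). b')⇒c') is for f itself. *)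

(* Defs.v *)
From HB Require Import structures.
From mathcomp Require Import all_boot all_order all_algebra.
From mathcomp Require Import all_classical all_reals all_analysis.

Set Implicit Arguments.
Unset Strict Implicit.
Unset Printing Implicit Defensive.

Import Order.TTheory GRing.Theory Num.Theory.
Import numFieldNormedType.Exports.

Local Open Scope classical_set_scope.
Local Open Scope ring_scope.

(* A process is a map [R -> T -> R], time first; only its values at times
   [0 <= t] matter. "Continuous", "increasing", "of finite variation" and
   "vanishing at 0" refer to every trajectory. *)

Section Processes.
Context {R : realType} {d : measure_display} {T : measurableType d}.
Variables (P : probability T R) (F : R -> set (set T)).

Record usual_filtration : Prop := UsualFiltration {
  filtration_sigma : forall t : R, 0 <= t -> sigma_algebra setT (F t) ;
  filtration_sub : forall t : R, 0 <= t -> F t `<=` measurable ;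
  filtration_mono : forall s t : R, 0 <= s -> s <= t -> F s `<=` F t ;
  filtration_right_continuous : forall t : R, 0 <= t ->
    \bigcap_(s in [set s | t < s]) F s `<=` F t ;
  filtration_complete : P.-negligible `<=` F 0 }.

Definition adapted (X : R -> T -> R) :=
  forall t : R, 0 <= t -> forall B : set R, measurable B -> F t (X t @^-1` B).

Definition continuous_paths (X : R -> T -> R) :=
  forall w, {within [set t | 0 <= t], continuous (fun t => X t w)}.

Definition nondecreasing_paths (X : R -> T -> R) :=
  forall w s t, 0 <= s -> s <= t -> X s w <= X t w.

Definition finite_variation_paths (X : R -> T -> R) :=
  forall w t, 0 <= t -> bounded_variation 0 t (fun s => X s w).

(* [E[M_t | F_s] = M_s], unfolded as equality of the integrals over every
   [A] in [F_s]. *)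
Record martingale (M : R -> T -> R) : Prop := Martingale {
  martingale_adapted : adapted M ;
  martingale_integrable : forall t : R, 0 <= t ->
    P.-integrable setT (fun w => (M t w)%:E) ;
  martingale_condexp : forall s t : R, 0 <= s -> s <= t -> forall A, F s A ->
    (\int[P]_(w in A) (M t w)%:E = \int[P]_(w in A) (M s w)%:E)%E }.

Record stopping_time (tau : T -> \bar R) : Prop := StoppingTime {
  stopping_time_ge0 : forall w, (0 <= tau w)%E ;
  stopping_time_meas : forall t : R, 0 <= t -> F t [set w | (tau w <= t%:E)%E] }.

Definition stopped (M : R -> T -> R) (tau : T -> \bar R) : R -> T -> R :=
  fun t w => M (fine (mine t%:E (tau w))) w.

(* All processes to which this is applied vanish at time 0. *)
Definition local_martingale (M : R -> T -> R) :=
  adapted M /\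
  exists tau : nat -> T -> \bar R,
    [/\ forall n, stopping_time (tau n),
        {ae P, forall w, forall n, (tau n w <= tau n.+1 w)%E},
        {ae P, forall w, tau n w @[n --> \oo] --> +oo%E} &
        forall n, martingale (stopped M (tau n))].

Record continuous_local_martingale0 (M : R -> T -> R) : Prop :=
  ContinuousLocalMartingale0 {
  clm_local_martingale : local_martingale M ;
  clm_continuous : continuous_paths M ;
  clm_0 : forall w, M 0 w = 0 }.

Record continuous_finite_variation0 (A : R -> T -> R) : Prop :=
  ContinuousFiniteVariation0 {
  cfv_adapted : adapted A ;
  cfv_continuous : continuous_paths A ;
  cfv_finite_variation : finite_variation_paths A ;
  cfv_0 : forall w, A 0 w = 0 }.

(* [M] is the martingale part of the continuous semimartingale [X]. *)
Definition martingale_part (X M : R -> T -> R) :=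
  continuous_local_martingale0 M /\
  exists2 A, continuous_finite_variation0 A &
    forall t w, 0 <= t -> X t w = M t w + A t w.

Definition semimartingale0 : set (R -> T -> R) :=
  [set X | exists M, martingale_part X M].

(* [Q] is (a version of) the square characteristic [<X>]: such a [Q] exists for
   every [X] in [semimartingale0], and is unique up to indistinguishability. *)
Definition square_characteristic (X Q : R -> T -> R) :=
  exists2 M, martingale_part X M &
    [/\ adapted Q, continuous_paths Q, nondecreasing_paths Q,
        forall w, Q 0 w = 0 &
        local_martingale (fun t w => M t w ^+ 2 - Q t w)].

(* [Q] is (a version of) the mutual characteristic [<X, Y>]. *)
Definition mutual_characteristic (X Y Q : R -> T -> R) :=
  exists M N, [/\ martingale_part X M, martingale_part Y N,
    continuous_finite_variation0 Q &
    local_martingale (fun t w => M t w * N t w - Q t w)].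

Record brownian_motion (W : R -> T -> R) : Prop := BrownianMotion {
  bm_adapted : adapted W ;
  bm_continuous : continuous_paths W ;
  bm_0 : {ae P, forall w, W 0 w = 0} ;
  bm_gaussian : forall s t : R, 0 <= s -> s < t ->
    forall B : set R, measurable B ->
      P [set w | B (W t w - W s w)] = normal_prob 0 (Num.sqrt (t - s)) B ;
  bm_independent : forall s t : R, 0 <= s -> s < t ->
    forall (A : set T) (B : set R), F s A -> measurable B ->
      P (A `&` [set w | B (W t w - W s w)]) =
      (P A * P [set w | B (W t w - W s w)%R])%E }.

(* A deterministic step integrand [\sum_i c_i 1_{]a_i, b_i]}] is given by the
   list of its triples [(c_i, a_i, b_i)]. *)
Definition steps (p : seq (R * R * R)) :=
  forall x, x \in p -> 0 <= x.1.2 /\ x.1.2 <= x.2.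

Definition step_fun (p : seq (R * R * R)) (u : R) : R :=
  \sum_(x <- p) x.1.1 * \1_(`]x.1.2, x.2]) u.

Definition step_integral (W : R -> T -> R) (p : seq (R * R * R)) :
  R -> T -> R :=
  fun t w => \sum_(x <- p)
    x.1.1 * (W (Num.min t x.2) w - W (Num.min t x.1.2) w).

(* [X] is (a continuous version of) the stochastic integral [h . W] of the
   deterministic locally square integrable function [h], i.e. the L^2-limit of
   the integrals of step functions approximating [h] in L^2([0, t]). *)
Definition stochastic_integral (W : R -> T -> R) (h : R -> R)
    (X : R -> T -> R) :=
  [/\ adapted X, continuous_paths X, forall w, X 0 w = 0 &
   exists p : nat -> seq (R * R * R), (forall n, steps (p n)) /\
    forall t : R, 0 <= t ->
      (\int[lebesgue_measure]_(u in `[0%R, t])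
         ((step_fun (p n) u - h u) ^+ 2)%:E)%E @[n --> \oo] --> 0%E /\
      (\int[P]_w ((step_integral W (p n) t w - X t w) ^+ 2)%:E)%E
        @[n --> \oo] --> 0%E].

Definition indicator_integrals (W : R -> T -> R) : set (R -> T -> R) :=
  [set X | exists a b, [/\ 0 <= a, a <= b &
     stochastic_integral W \1_(`[a, b]) X]].

(* The characteristics being defined up to indistinguishability, the equation
   is required for all their versions. *)
Definition solution (V : set (R -> T -> R)) (f : R -> R -> R) :=
  forall X Y, V X -> V Y ->
  forall QX QY QXY QS,
    square_characteristic X QX -> square_characteristic Y QY ->
    mutual_characteristic X Y QXY ->
    square_characteristic (fun t w => X t w + Y t w) QS ->
  forall t : R, 0 <= t ->
    {ae P, forall w, f (QX t w) (X t w) * f (QY t w) (Y t w) =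
                     f (QS t w) (X t w + Y t w + QXY t w)}.

End Processes.

Section HalfPlane.
Context {R : realType}.

Definition half_plane : set (R * R) := [set x | 0 <= x.1].

Definition continuous2 (f : R -> R -> R) :=
  {within half_plane, continuous (fun x : R * R => f x.1 x.2)}.

Definition measurable2 (f : R -> R -> R) :=
  measurable_fun half_plane (fun x : R * R => f x.1 x.2).

Definition strictly_positive2 (f : R -> R -> R) :=
  forall u v, 0 <= u -> 0 < f u v.

Definition ae_eq2 (f g : R -> R -> R) :=
  {ae (lebesgue_measure \x lebesgue_measure)%E, forall x : R * R,
    half_plane x -> f x.1 x.2 = g x.1 x.2}.

Definition exp_fun (c u v : R) : R := expR (c * v - c / 2 * u).

End HalfPlane.

(* Main.v *)
(** (c) => (a): for [exp_fun k] the equation at time [t] says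
    [<X+Y> = <X> + <Y> + 2 <X,Y>].  The difference of the two sides is a sum of
    local martingales with continuous paths of finite variation, so one has to
    show that such a process vanishes.  A continuous martingale [S] observed on
    a grid is stopped when its grid variation exceeds [K]; a convex function of
    linear growth (Huber's) of the stopped value has expectation at most
    [2 K E m + E (m |S_t|)], where [m] bounds the increments over the grid (cut
    off at 2), and this tends to 0 with the mesh.  Working on grids makes
    continuous-time optional stopping unnecessary.

    (b) => (c): testing with [X = 1_[0,u] . W], [Y = 1_[u,u+v] . W], and with
    [X = Y = 1_[0,u] . W], shows that [L = ln f] satisfies
    [L u x + L v y = L (u+v) (x+y)] and [2 L u x = L (4u) (2x+u)] for almost all
    [x, y], since Gaussian laws have positive densities.  For each [u] such an [L u] is
    locally essentially bounded, and averaging over [y] shows that it has a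
    continuous version; hence [L u x = c x + D u] with [D] additive, and the second
    equation forces [D u = - c u / 2]. *)

Require Import Defs.
From HB Require Import structures.
From mathcomp Require Import all_boot all_order all_algebra.
From mathcomp Require Import all_classical all_reals all_analysis.
From mathcomp Require Import measurable_realfun ring lra.
Import Order.TTheory GRing.Theory Num.Theory.
Import numFieldNormedType.Exports.
Local Open Scope classical_set_scope.
Local Open Scope ring_scope.
Set Implicit Arguments.
Unset Strict Implicit.
Unset Printing Implicit Defensive.

(** * Moments of the normal distribution *)

(** Why Huber's function: a martingale here is only integrable, so the usual expansion of squares of
    increments may have infinite expectation. [huber] is quadratic near 0, which makes the remainder
    at each step small with the mesh, and it grows linearly, which keeps all expectations finite.
    The increment at which the variation crosses [K] stays uncontrolled; it is traded for the
    terminal value by the martingale property, and this is the term [E (m |S_t|)]. [solution]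
    quantifies over all versions of the characteristics, each with its own decomposition, so
    martingale parts must be identified as well; this is again the vanishing statement. In the other
    direction the equation yields nothing until explicit characteristics of the Brownian integrals
    are exhibited; hence the Gaussian moments, which make [X ^+ 2 - <X>] a martingale. All equations
    are extracted for [u > 0], where the increment has a density. The line [u = 0] is reached by
    continuity in (1) and is a null set in (2). *)

Section NormalMoments.
Context {R : realType}.
Variable s : R.
Hypothesis s0 : s != 0.
Local Notation N := (normal_prob 0 s).
Local Notation mu := (@lebesgue_measure R).
Local Notation pdf := (normal_pdf 0 s).

(** Uniqueness of densities: the Radon-Nikodym derivative of [N] and [pdf] have the same integral
    over every measurable set, so they agree almost everywhere. *)
Lemma integral_normal_prob U (f : R -> R) : measurable U ->
  N.-integrable U (EFin \o f) ->
  (\int[N]_(x in U) (f x)%:E = \int[mu]_(x in U) (f x * pdf x)%:E)%E.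
Proof.
move=> mU intf; have mf := measurable_int _ intf.
have dom := @normal_prob_dominates R 0 s.
rewrite -(Radon_Nikodym_change_of_variables dom)//=.
under [RHS]eq_integral do rewrite EFinM.
apply: ae_eq_integral => //.
- apply: emeasurable_funM => //; apply: (measurable_int mu).
  apply: (integrableS _ _ (@subsetT _ _)) => //=.
  exact: Radon_Nikodym_integrable.
- apply: emeasurable_funM => //; apply/measurable_EFinP/measurable_funTS.
  exact: measurable_normal_pdf.
- apply: ae_eqe_mul2l => /=.
  apply: integral_ae_eq => //=.
  + apply: (integrableS _ _ (@subsetT _ _)) => //=.
    exact: Radon_Nikodym_integrable.
  + by apply/measurable_funTS/measurableT_comp => //; exact: measurable_normal_pdf.
  + by move=> E EU mE; rewrite -Radon_Nikodym_integral.
Qed.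

Lemma is_derive_normal_pdf (x : R) :
  is_derive x 1 pdf (- (x / s ^+ 2) * pdf x).
Proof.
have pdfE : pdf = (fun x => normal_peak s * expR (- (s ^+ 2 *+ 2)^-1 * (x * x))).
  apply/funext => y; rewrite normal_pdfE//; congr (_ * expR _).
  by rewrite subr0 expr2; ring.
rewrite pdfE; have s2 : s ^+ 2 != 0 by rewrite sqrf_eq0.
apply: is_derive_eq.
rewrite !scaler1 /GRing.scale/=.
by field; rewrite s0.
Qed.

(** Centring the integrand at its expected value [s ^+ 2 + a ^+ 2] makes it an exact derivative:
    [- s ^+ 2 * pdf] is a primitive of [x * pdf], and integrating [x ^+ 2 * pdf] by parts leaves
    [s ^+ 2] times the integral of [pdf], which cancels. *)
Definition moment_primitive a (x : R) : R := - s ^+ 2 * (x + 2 * a) * pdf x.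

Lemma is_derive_moment_primitive a (x : R) :
  is_derive x 1 (moment_primitive a)
    (((x + a) ^+ 2 - (s ^+ 2 + a ^+ 2)) * pdf x).
Proof.
have dp := is_derive_normal_pdf x.
rewrite (_ : moment_primitive a = (fun x => - s ^+ 2 * (x + 2 * a)) * pdf)//.
apply: is_derive_eq.
rewrite /GRing.scale/= addr0.
by field; rewrite s0.
Qed.

(** From [1 + y <= expR y] at [y = x ^+ 2 / (2 * s ^+ 2)]. Quadratic decay is enough to beat the
    linear factor of [moment_primitive]. *)
Lemma normal_pdf_bound (x : R) : x != 0 ->
  pdf x <= normal_peak s * (2 * s ^+ 2) / x ^+ 2.
Proof.
move=> x0; rewrite normal_pdfE// -mulrA ler_wpM2l ?normal_peak_ge0//.
rewrite /normal_fun subr0 mulNr expRN -[leRHS]invrK lef_pV2 ?posrE ?expR_gt0//.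
  rewrite (le_trans _ (expR_ge1Dx _))// invfM invrK mulrC mulr_natl.
  by rewrite lerDr ler01.
have s2 : 0 < s ^+ 2 by rewrite exprn_even_gt0.
have x2 : 0 < x ^+ 2 by rewrite exprn_even_gt0.
by rewrite invr_gt0 divr_gt0// mulr_gt0.
Qed.

Lemma moment_primitive_cvg0 a (e : bool) :
  moment_primitive a ((-1) ^+ e * n.+1%:R) @[n --> \oo] --> 0.
Proof.
apply/cvgr0Pnorm_le => eps eps0.
(* At distance [n.+1] from 0 the factor [x + 2 * a] is at most [(1 + 2 * |a|) * n.+1], and the
   density is bounded by [normal_pdf_bound]; together they give [C / n.+1]. *)
pose C := s ^+ 2 * (1 + 2 * `|a|) * (normal_peak s * (2 * s ^+ 2)).
have C0 : 0 <= C.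
  have a0 : 0 <= 1 + 2 * `|a| by rewrite addr_ge0// mulr_ge0.
  have p0 := normal_peak_ge0 s; have s20 := sqr_ge0 s.
  by rewrite /C; apply: mulr_ge0; apply: mulr_ge0 => //; apply: mulr_ge0.
exists (Num.bound (C / eps)) => // n /= hn.
have n0 : 0 < n.+1%:R :> R by [].
have nb : C / n.+1%:R <= eps.
  rewrite ler_pdivrMr// mulrC -ler_pdivrMr// ltW//.
  apply: (lt_le_trans (archi_boundP _)); first by rewrite divr_ge0// ltW.
  by rewrite ler_nat (leq_trans hn).
apply: le_trans nb.
set x := (-1) ^+ e * _.
have nx : `|x| = n.+1%:R by rewrite normrM normrX normrN1 expr1n mul1r ger0_norm.
have x0 : x != 0 by rewrite -normr_eq0 nx gt_eqF.
have xx : x ^+ 2 = n.+1%:R ^+ 2 by rewrite -[LHS]ger0_norm ?sqr_ge0// normrX nx.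
rewrite /moment_primitive !normrM normrN (ger0_norm (sqr_ge0 _)).
rewrite (ger0_norm (normal_pdf_ge0 _ _ _)).
have h1 : `|x + 2 * a| <= (1 + 2 * `|a|) * n.+1%:R.
  rewrite (le_trans (ler_normD _ _))// nx normrM (ger0_norm (ler0n _ 2)).
  have : 0 <= (2 * `|a|) * (n.+1%:R - 1) by rewrite !mulr_ge0// subr_ge0 ler1n.
  lra.
apply: (@le_trans _ _ (s ^+ 2 * ((1 + 2 * `|a|) * n.+1%:R) *
    (normal_peak s * (2 * s ^+ 2) / n.+1%:R ^+ 2))).
  apply: ler_pM.
  - by rewrite mulr_ge0// sqr_ge0.
  - exact: normal_pdf_ge0.
  - by rewrite ler_wpM2l// sqr_ge0.
  - by rewrite -xx normal_pdf_bound.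
rewrite le_eqVlt; apply/orP; left; apply/eqP; rewrite /C.
by field; rewrite gt_eqF.
Qed.

Let I n : set R := `[- n.+1%:R, n.+1%:R]%classic.

Lemma normal_truncated_moment a n :
  (\int[N]_(x in I n) ((x + a) ^+ 2)%:E =
   ((s ^+ 2 + a ^+ 2) * fine (N (I n)) +
    (moment_primitive a n.+1%:R - moment_primitive a (- n.+1%:R)))%:E)%E.
Proof.
have mI : measurable (I n) by exact: measurable_itv.
have cpoly : continuous (fun x : R => (x + a) ^+ 2 : R).
  by move=> x; apply: (@continuousM _ _ (fun x => x + a) (fun x => x + a));
    apply: cvgD; [exact: cvg_id|exact: cvg_cst|exact: cvg_id|exact: cvg_cst].
have bnd c : N.-integrable (I n) (EFin \o (fun x : R => (x + a) ^+ 2 - c)).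
  apply: measurable_bounded_integrable => //.
  - by rewrite (le_lt_trans (probability_le1 _ _))// ltry.
  - apply: measurable_funTS; apply: measurable_funB => //.
    exact: continuous_measurable_fun.
  - exists ((n.+1%:R + `|a|) ^+ 2 + `|c|); split; first exact: num_real.
    move=> M hM x; rewrite /I/= in_itv/= -ler_norml => xn.
    rewrite ltW// (le_lt_trans _ hM)// (le_trans (ler_normB _ _))// lerD2r.
    rewrite normrX lerXn2r ?nnegrE ?addr_ge0// (le_trans (ler_normD _ _))//.
    by rewrite lerD2r.
have h0 := bnd 0; have h1 := bnd (s ^+ 2 + a ^+ 2).
(* The constant part contributes a multiple of [N (I n)], whose limit is known; only the centred
   part goes through the fundamental theorem of calculus. *)
have -> : (\int[N]_(x in I n) ((x + a) ^+ 2)%:E =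
    \int[N]_(x in I n) ((s ^+ 2 + a ^+ 2) + ((x + a) ^+ 2 - (s ^+ 2 + a ^+ 2)))%:E)%E.
  by apply: eq_integral => x _; congr (_%:E); ring.
under eq_integral do rewrite EFinD.
rewrite integralD//=; last exact: finite_measure_integrable_cst.
rewrite integral_cst//= [RHS]EFinD [in RHS]EFinM fineK ?fin_num_measure//; congr (_ + _)%E.
rewrite integral_normal_prob// EFinB.
apply: continuous_FTC2.
- by rewrite (@lt_trans _ _ 0)// oppr_lt0.
- apply: continuous_subspaceT => x; apply: cvgM.
    by apply: cvgB; [exact: cpoly|exact: cvg_cst].
  exact: (@continuous_normal_pdf R 0 s s0 x).
- have cF x : {for x, continuous (moment_primitive a)}.
    have [h _] := is_derive_moment_primitive a x.
    exact/differentiable_continuous/derivable1_diffP.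
  split.
  + by move=> x _; have [] := is_derive_moment_primitive a x.
  + exact/cvg_at_right_filter/cF.
  + exact/cvg_at_left_filter/cF.
- by move=> x _; rewrite derive1E; have [_ ->] := is_derive_moment_primitive a x.
Qed.

(* Shifted second moments have nonnegative integrands, so monotone convergence
   suffices; [a = 0] and [a = 1] together give the variance and the mean. *)
Lemma normal_shifted_moment a :
  (\int[N]_x ((x + a) ^+ 2)%:E = (s ^+ 2 + a ^+ 2)%:E)%E.
Proof.
have mI n : measurable (I n) by exact: measurable_itv.
have ndI : nondecreasing_seq I.
  apply/nondecreasing_seqP => n; rewrite subsetEset => x.
  rewrite /I/= !in_itv/= => /andP[h1 h2].
  have n12 : n.+1%:R <= n.+2%:R :> R by rewrite ler_nat.
  by apply/andP; split; [rewrite (le_trans _ h1)// lerN2|exact: le_trans n12].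
have IT : \bigcup_n I n = setT.
  apply/seteqP; split => // x _; exists (Num.bound `|x|) => //.
  rewrite /I/= in_itv/= -ler_norml ltW//.
  apply: (lt_le_trans (archi_boundP _)) => //.
  by rewrite ler_nat.
have mf : measurable_fun setT (fun x : R => ((x + a) ^+ 2)%:E).
  by apply/measurable_EFinP/measurable_funX/measurable_funD.
have c1 : (\int[N]_(x in I n) ((x + a) ^+ 2)%:E @[n --> \oo] -->
    \int[N]_x ((x + a) ^+ 2)%:E)%E.
  rewrite -IT; apply: ge0_nondecreasing_set_cvg_integral => //.
    by move=> n; apply: measurable_funTS.
  by move=> n x _; rewrite lee_fin sqr_ge0.
have c2 : fine (N (I n)) @[n --> \oo] --> (1 : R).
  have := nondecreasing_cvg_mu mI _ ndI (mu := N).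
  rewrite IT => /(_ measurableT).
  rewrite [X in _ --> X](_ : _ = 1%E); last exact: probability_setT.
  by move=> h; exact: (fine_cvg h).
apply: (cvg_unique _ c1) => //.
rewrite (_ : (fun _ => _) = (fun n => ((s ^+ 2 + a ^+ 2) * fine (N (I n)) +
    (moment_primitive a n.+1%:R - moment_primitive a (- n.+1%:R)))%:E)); last first.
  by apply/funext => n; exact: normal_truncated_moment.
apply: cvg_EFin; first exact: nearW.
rewrite -[X in _ --> X]addr0; apply: cvgD.
  by rewrite -[X in _ --> X]mulr1; apply: cvgM => //; exact: cvg_cst.
rewrite -[X in _ --> X](subrr 0); apply: cvgB.
  have := moment_primitive_cvg0 a false.
  by under eq_fun do rewrite expr0 mul1r.
have := moment_primitive_cvg0 a true.
by under eq_fun do rewrite expr1 mulN1r.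
Qed.

End NormalMoments.

(** * Continuous martingales of finite variation *)

Section Huber.
Context {R : realType}.
Implicit Types c x y : R.

Definition clip x : R := Num.max (-1) (Num.min 1 x).

(* [huber x] is the maximum of [c * x - c ^+ 2 / 2] over [`|c| <= 1], attained at
   [c = clip x]; both [huber_ge] and [huber_step] rest on this. *)
Definition huber x : R := clip x * x - clip x ^+ 2 / 2.

Lemma clip_le1 x : `|clip x| <= 1.
Proof.
rewrite ler_norml /clip; apply/andP; split; first by rewrite le_max lexx.
by rewrite ge_max ge_min lexx/= andbT; lra.
Qed.

Variant clip_spec x : R -> Prop :=
| ClipLt of x <= -1 : clip_spec x (-1)
| ClipMid of -1 <= x & x <= 1 : clip_spec x x
| ClipGt of 1 <= x : clip_spec x 1.

Lemma clipP x : clip_spec x (clip x).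
Proof.
rewrite /clip; case: (lerP 1 x) => [x1|/ltW x1].
  by rewrite max_r; [constructor|lra].
case: (lerP (-1) x) => [xN1|/ltW xN1]; first by constructor.
by constructor.
Qed.

(** [clip] is the projection onto an interval of length 2, hence 1-Lipschitz and of oscillation at
    most 2. This is the origin of the cut-off in [trunc_incr]. *)
Lemma clipB_le x y : `|clip y - clip x| <= Num.min `|y - x| 2.
Proof.
rewrite le_min; apply/andP; split; last first.
  have := clip_le1 x; have := clip_le1 y; rewrite !ler_norml; lra.
rewrite ler_norml; have := ler_norm (y - x); have := ler_norm (- (y - x)).
by rewrite normrN; case: (clipP x); case: (clipP y); lra.
Qed.

Lemma huber_ge c x : `|c| <= 1 -> c * x - c ^+ 2 / 2 <= huber x.
Proof.
rewrite ler_norml => /andP[c1 c2].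
rewrite /huber; case: clipP => [x1|x1 x2|x1].
- have : 0 <= (c + 1) * (- 1 - x) by rewrite mulr_ge0//; lra.
  have : 0 <= (c + 1) ^+ 2 by rewrite sqr_ge0.
  lra.
- have : 0 <= (c - x) ^+ 2 by rewrite sqr_ge0.
  lra.
- have : 0 <= (1 - c) * (x - 1) by rewrite mulr_ge0//; lra.
  have : 0 <= (c - 1) ^+ 2 by rewrite sqr_ge0.
  lra.
Qed.

(** The slope [clip y], optimal at [y], is tested at [x]: this gives
    [huber y <= huber x + clip y * (y - x)]. Replacing [clip y] by [clip x] costs the last term. *)
Lemma huber_step x y :
  huber y <= huber x + clip x * (y - x) + `|y - x| * Num.min `|y - x| 2.
Proof.
have h := huber_ge x (clip_le1 y).
have h1 : (clip y - clip x) * (y - x) <= `|y - x| * Num.min `|y - x| 2.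
  by rewrite (le_trans (ler_norm _))// normrM mulrC ler_wpM2l// clipB_le.
by rewrite {1}/huber; lra.
Qed.

Lemma huber0 : huber 0 = 0.
Proof.
by rewrite /huber /clip min_r// max_r ?lerN10// mul0r expr0n/= mul0r subr0.
Qed.

Lemma huber_ge0 x : 0 <= huber x.
Proof.
by have := @huber_ge 0 x; rewrite normr0 mul0r expr0n/= mul0r subr0; apply.
Qed.

Lemma huber_eq0 x : huber x = 0 -> x = 0.
Proof.
rewrite /huber; case: clipP => [x1|x1 x2 h|x1]; [lra| |lra].
by apply/eqP; rewrite -sqrf_eq0; apply/eqP; lra.
Qed.

Lemma huber_le_norm x : huber x <= `|x|.
Proof.
rewrite /huber (@le_trans _ _ (clip x * x))//.
  by rewrite lerBlDr lerDl divr_ge0// sqr_ge0.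
rewrite (le_trans (ler_norm _))// normrM.
by rewrite ler_piMl// clip_le1.
Qed.

End Huber.

(** * Sub-sigma-algebras, integrable variables and bounded multipliers *)

Section SubSigma.
Context {R : realType} {d : measure_display} {T : measurableType d}.
Implicit Types (G : set (set T)) (H : T -> R).

Definition smeas G H := forall B : set R, measurable B -> G (H @^-1` B).

(** [G] generates itself, so the closure properties of measurable functions become available for
    [smeas]. *)
Lemma smeasP G H : sigma_algebra setT G ->
  smeas G H <-> measurable_fun setT (H : g_sigma_algebraType G -> R).
Proof.
move=> sG; split=> h.
  move=> _ B mB; rewrite setTI; have := h _ mB.
  by rewrite -{1}(measurable_g_measurableTypeE sG).
move=> B mB; have := h measurableT _ mB; rewrite setTI.
by rewrite (measurable_g_measurableTypeE sG).
Qed.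

Lemma smeas_measurable G H : G `<=` measurable -> smeas G H ->
  measurable_fun setT H.
Proof. by move=> Gm h _ B mB; rewrite setTI; apply: Gm; exact: h. Qed.

End SubSigma.

Section Integrals.
Context {R : realType} {d : measure_display} {T : measurableType d}.
Variables (P : probability T R).
Implicit Types (H X Y : T -> R).

Definition rint X := P.-integrable setT (EFin \o X).

Lemma rint_measurable X : rint X -> measurable_fun setT X.
Proof. by move/measurable_int/measurable_EFinP. Qed.

Lemma rintD X Y : rint X -> rint Y -> rint (fun w => X w + Y w).
Proof. by move=> iX iY; exact: (integrableD measurableT iX iY). Qed.

Lemma rintB X Y : rint X -> rint Y -> rint (fun w => X w - Y w).
Proof. by move=> iX iY; exact: (integrableB measurableT iX iY). Qed.

Lemma rintZ k X : rint X -> rint (fun w => k * X w).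
Proof. by move=> iX; exact: (integrableZl measurableT k iX). Qed.

Lemma rint_le X Y : measurable_fun setT X -> rint Y ->
  (forall w, `|X w| <= `|Y w|) -> rint X.
Proof.
move=> mX iY XY; apply: (le_integrable measurableT _ _ iY).
  exact/measurable_EFinP.
by move=> w _; rewrite /= lee_fin.
Qed.

Lemma rint_cst k : rint (fun=> k).
Proof. exact: finite_measure_integrable_cst. Qed.

Lemma rint_bounded X C : measurable_fun setT X -> (forall w, `|X w| <= C) ->
  rint X.
Proof.
move=> mX XC; apply: (rint_le mX (rint_cst C)) => w.
by rewrite (le_trans (XC w))// ler_norm.
Qed.

Lemma rint_norm X : rint X -> rint (fun w => `|X w|).
Proof. by move=> iX; exact: (integrable_abse iX). Qed.

Lemma rint_mul_bounded H X C : measurable_fun setT H ->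
  (forall w, `|H w| <= C) -> rint X -> rint (fun w => H w * X w).
Proof.
move=> mH HC iX; apply: (@rint_le _ (fun w => C * X w)).
- by apply: measurable_funM => //; exact: rint_measurable.
- exact: rintZ.
- move=> w; rewrite !normrM ler_wpM2r// (le_trans (HC w))//; exact: ler_norm.
Qed.

Lemma rint_sum n (F : nat -> T -> R) : (forall i, (i < n)%N -> rint (F i)) ->
  rint (fun w => \sum_(i < n) F i w).
Proof.
elim: n => [|n ih] iF.
  by under [X in rint X]eq_fun do rewrite big_ord0; exact: rint_cst.
under [X in rint X]eq_fun do rewrite big_ord_recr/=.
by apply: rintD; [apply: ih => i /ltnW/iF|apply: iF].
Qed.

Lemma Rintegral_sum_ord n (F : nat -> T -> R) :
  (forall i, (i < n)%N -> rint (F i)) ->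
  \int[P]_w (\sum_(i < n) F i w) = \sum_(i < n) \int[P]_w F i w.
Proof.
elim: n => [|n ih] iF.
  under eq_Rintegral do rewrite big_ord0.
  by rewrite big_ord0 Rintegral_cst// mul0r.
under eq_Rintegral do rewrite big_ord_recr/=.
rewrite RintegralD//; last by apply: iF.
- by rewrite big_ord_recr/= ih// => i /ltnW/iF.
- by apply: rint_sum => i /ltnW/iF.
Qed.

Lemma Rintegral_indicM A X : measurable A ->
  \int[P]_w (\1_A w * X w) = \int[P]_(w in A) X w.
Proof.
move=> mA; rewrite [RHS]Rintegral_mkcond; apply: eq_Rintegral => w _.
by rewrite patchE indicE; case: ifPn => _; rewrite ?mul1r ?mul0r.
Qed.

Lemma rint_indicM A X : measurable A -> rint X -> rint (fun w => \1_A w * X w).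
Proof.
move=> mA iX; apply: (@rint_mul_bounded _ _ 1) => //.
by move=> w; rewrite indicE; case: (_ \in _); rewrite ?normr1 ?normr0.
Qed.

End Integrals.

Section Multiplier.
Context {R : realType} {d : measure_display} {T : measurableType d}.
Variables (P : probability T R) (G : set (set T)).
Hypothesis sG : sigma_algebra setT G.
Hypothesis Gm : G `<=` measurable.
Implicit Types (H D : T -> R).
Local Notation rint := (rint P).

(* The sum counts the positive integers up to [y], i.e. it is the integer part of
   [y] as long as [y < n]. *)
Lemma layer_count (y : R) (n : nat) : 0 <= y ->
  let s := \sum_(i < n) \1_`[i.+1%:R, +oo[%classic y in
  if n%:R <= y then s = n%:R else y - 1 <= s <= y.
Proof.
move=> y0; elim: n => [|n ih] /=.
  by rewrite big_ord0 y0.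
rewrite big_ord_recr/= indicE; move: ih => /=.
set s := \sum_(i < n) _ => ih.
have -> : (y \in `[n.+1%:R, +oo[%classic) = (n.+1%:R <= y).
  apply/idP/idP => [/set_mem/=|h]; first by rewrite in_itv/= andbT.
  by apply/mem_set; rewrite /= in_itv/= andbT.
case: ifPn => [ny|/negbTE ny].
  have nly : n%:R <= y by rewrite (le_trans _ ny)// ler_nat.
  by rewrite nly in ih; rewrite ih ny -natr1.
rewrite ny addr0; move/negbT: ny; rewrite -ltNge -natr1 => ny.
by case: ifPn ih => // nly ->; apply/andP; split; lra.
Qed.

(** The last hypothesis says that [D] has conditional expectation 0 given [G]. A bounded multiplier
    is, up to a uniform error, a finite combination of indicators of events of [G]. *)
Lemma Rintegral_mul_eq0 H D C : smeas G H -> (forall w, `|H w| <= C) ->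
  rint D -> (forall A, G A -> \int[P]_(w in A) D w = 0) ->
  \int[P]_w (H w * D w) = 0.
Proof.
move=> mGH HC iD D0.
have mH : measurable_fun setT H by exact: smeas_measurable mGH.
have iHD : rint (fun w => H w * D w) by exact: (rint_mul_bounded mH HC iD).
(* [layer_count] needs a nonnegative argument; the shift is harmless because [D] has mean 0. *)
pose K w := H w + C.
have K0 w : 0 <= K w.
  by have := HC w; rewrite ler_norml => /andP[]; rewrite /K; lra.
have KC w : K w <= 2 * C.
  by have := HC w; rewrite ler_norml => /andP[]; rewrite /K; lra.
have mK : measurable_fun setT K by apply: measurable_funD.
have iKD : rint (fun w => K w * D w).
  apply: (@rint_mul_bounded _ _ _ _ _ _ (2 * C)) => // w.
  by rewrite ger0_norm.
have DT : \int[P]_w D w = 0.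
  by apply: D0; case: sG => [g0 gC _]; rewrite -(setD0 setT); exact: gC.
have -> : \int[P]_w (H w * D w) = \int[P]_w (K w * D w).
  transitivity (\int[P]_w (K w * D w - C * D w)).
    by apply: eq_Rintegral => w _; rewrite /K; ring.
  by rewrite RintegralB// ?RintegralZl//; [rewrite DT mulr0 subr0|exact: rintZ].
apply/eqP; rewrite -normr_le0; apply/ler_addgt0Pr => e e0; rewrite add0r.
(* Chosen so that the error, the mean of [|D|] divided by [m.+1], is at most [e]. *)
pose m := Num.bound (\int[P]_w `|D w| / e).
have m0 : 0 < (m.+1)%:R :> R by rewrite ltr0n.
(* [K * m.+1] stays below [N], so the second branch of [layer_count] applies. *)
pose N := Num.bound (2 * C * m.+1%:R).
pose A i := [set w | i.+1%:R <= K w * m.+1%:R].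
have GA i : G (A i).
  have -> : A i = H @^-1` `[i.+1%:R / m.+1%:R - C, +oo[.
    apply/seteqP; split=> w; rewrite /A/= in_itv/= andbT /K.
      by rewrite -ler_pdivrMr// lerBlDr.
    by rewrite -ler_pdivrMr// lerBlDr.
  exact: mGH.
have mA i : measurable (A i) by exact: Gm.
pose L w := \sum_(i < N) m.+1%:R^-1 * (\1_(A i) w * D w).
have iL i : rint (fun w => m.+1%:R^-1 * (\1_(A i) w * D w)).
  by apply: rintZ; exact: rint_indicM.
have L0 : \int[P]_w L w = 0.
  rewrite (@Rintegral_sum_ord _ _ _ P N
    (fun i w => m.+1%:R^-1 * (\1_(A i) w * D w)))// big1// => i _.
  rewrite RintegralZl//; last exact: rint_indicM.
  by rewrite Rintegral_indicM// D0// mulr0.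
have irL : rint L.
  exact: (@rint_sum _ _ _ P N (fun i w => m.+1%:R^-1 * (\1_(A i) w * D w))).
rewrite -[X in `|X|]subr0 -L0 -RintegralB//.
apply: le_trans (le_normr_Rintegral _ _) _ => //; first exact: rintB.
apply: (@le_trans _ _ (\int[P]_w (m.+1%:R^-1 * `|D w|))).
  apply: le_Rintegral => //.
  - by apply: rint_norm; exact: rintB.
  - by apply: rintZ; exact: rint_norm.
  - move=> w _; rewrite /L -mulr_sumr -mulr_suml mulrA -mulrBl normrM.
    rewrite ler_wpM2r//.
    have := @layer_count (K w * m.+1%:R) N; rewrite mulr_ge0 ?K0// => /(_ erefl) /=.
    have -> : \sum_(i < N) \1_`[i.+1%:R, +oo[%classic (K w * m.+1%:R) =
              \sum_(i < N) \1_(A i) w :> R.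
      apply: eq_bigr => i _; rewrite !indicE; congr (_%:R).
      congr (nat_of_bool _); apply/idP/idP => [/set_mem/=|/set_mem h].
        by rewrite in_itv/= andbT => h; exact/mem_set.
      by apply/mem_set; rewrite /= in_itv/= andbT.
    rewrite ifF; last first.
      have CC : 0 <= C by rewrite (le_trans _ (HC point)).
      apply/negbTE; rewrite -ltNge.
      apply: (@le_lt_trans _ _ (2 * C * m.+1%:R)); first by rewrite ler_wpM2r.
      by apply: archi_boundP; rewrite !mulr_ge0.
    set s := \sum_(i < N) _ => /andP[h1 h2].
    rewrite ger0_norm; last first.
      by rewrite subr_ge0 mulrC ler_pdivrMr.
    rewrite -(ler_pM2r m0) mulrBl mulVf ?gt_eqF// mulrAC mulVf ?gt_eqF// mul1r.
    by lra.
rewrite RintegralZl//; last exact: rint_norm.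
rewrite mulrC ler_pdivrMr// -ler_pdivrMl// mulrC ltW//.
apply: (lt_le_trans (archi_boundP _)); last by rewrite ler_nat leqnSn.
apply: divr_ge0; [exact: Rintegral_ge0|exact: ltW].
Qed.

End Multiplier.

(** * Pathwise estimate for a sequence stopped when its variation exceeds [K] *)

Section StoppedSequence.
Context {R : realType}.
Variables (s : nat -> R) (K : R).

Definition incr (j : nat) : R := s j.+1 - s j.
Definition svar (n : nat) : R := \sum_(j < n) `|incr j|.
Definition alive (n : nat) : R := (svar n <= K)%R%:R.
(** [alive j] depends only on [s 0, ..., s j], so for a martingale this is a martingale transform.
    The increment that carries the variation across [K] is included. *)
Definition sstop (n : nat) : R := \sum_(j < n) alive j * incr j.
Definition trunc_incr (j : nat) : R := Num.min `|incr j| 2.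
(* Nonzero only at the increment at which the sequence gets stopped; that increment
   is not controlled by [K], and is handled through the martingale property of
   [s j.+1] (see [discrete_bound]). *)
Definition overshoot (j : nat) : R :=
  (alive j - alive j.+1) * trunc_incr j * Num.sg (s j.+1).

Lemma svarS n : svar n.+1 = svar n + `|incr n|.
Proof. by rewrite /svar big_ord_recr. Qed.

Lemma alive_nincr n : alive n.+1 <= alive n.
Proof.
rewrite /alive ler_nat svarS; case: (leP (svar n + _) K) => // h.
by rewrite (le_trans _ h)// lerDl.
Qed.

Lemma alive_spec n : alive n = 1 /\ svar n <= K \/ alive n = 0.
Proof. by rewrite /alive; case: (leP (svar n) K) => h; [left|right]. Qed.

Lemma trunc_incr_ge0 j : 0 <= trunc_incr j.
Proof. by rewrite /trunc_incr le_min normr_ge0/=. Qed.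

Hypotheses (s0 : s 0%N = 0) (K0 : 0 <= K).

Lemma norm_le_svar n : `|s n| <= svar n.
Proof.
elim: n => [|n ih]; first by rewrite s0 normr0 /svar big_ord0.
rewrite svarS; have -> : s n.+1 = s n + incr n by rewrite /incr; ring.
by rewrite (le_trans (ler_normD _ _))// lerD2r.
Qed.

Lemma sstop_alive n : alive n = 1 -> sstop n = s n.
Proof.
elim: n => [|n ih] an; first by rewrite /sstop big_ord0 s0.
have an1 : alive n = 1.
  have := alive_nincr n; rewrite an; case: (alive_spec n) => [[]//|->]; lra.
rewrite /sstop big_ord_recr/= -/(sstop n) ih// an1 /incr; ring.
Qed.

(** [huber_step] summed along the stopped sequence. The terms with [clip] form a martingale
    transform and will vanish in expectation. *)
Lemma huber_sstop n : huber (sstop n) <= \sum_(j < n)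
  (alive j * clip (sstop j) * incr j + alive j * `|incr j| * trunc_incr j).
Proof.
elim: n => [|n ih]; first by rewrite /sstop !big_ord0 huber0.
rewrite big_ord_recr/=; apply: (le_trans _ (lerD ih (lexx _))).
have := huber_step (sstop n) (sstop n.+1).
have -> : sstop n.+1 - sstop n = alive n * incr n.
  by rewrite /sstop big_ord_recr/=; ring.
have := trunc_incr_ge0 n; rewrite /trunc_incr.
case: (alive_spec n) => [[-> _]|->]; rewrite ?mul1r ?mul0r; first lra.
by rewrite normr0 !mul0r; lra.
Qed.

(** The index [j.+1] leaves out the crossing increment: the sum is the variation up to a time at
    which it is still at most [K]. *)
Lemma sum_alive_incr n : \sum_(j < n) alive j.+1 * `|incr j| <= K.
Proof.
elim: n => [|n ih]; first by rewrite big_ord0.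
case: (alive_spec n.+1) => [[_ h]|h]; last first.
  by rewrite big_ord_recr/= h mul0r addr0.
rewrite (le_trans _ h)// /svar; apply: ler_sum => j _.
rewrite -[leRHS]mul1r ler_wpM2r// /alive.
by case: (svar j.+1 <= K) => /=.
Qed.

Lemma sum_alive_drop n : \sum_(j < n) (alive j - alive j.+1) = alive 0 - alive n.
Proof.
elim: n => [|n ih]; first by rewrite big_ord0 subrr.
by rewrite big_ord_recr/= ih; ring.
Qed.

Lemma alive_drop_le1 n : alive 0 - alive n <= 1.
Proof.
by case: (alive_spec n) => [[-> _]|->]; case: (alive_spec 0) => [[-> _]|->]; lra.
Qed.

Variables (m : R) (N : nat).
Hypotheses (m0 : 0 <= m) (ltm : forall j, (j < N)%N -> trunc_incr j <= m).

(** The remainders of [huber_sstop] split in two. Increments before the crossing contribute at most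
    [K * m]. The crossing one contributes another [K * m] through [s j], plus the overshoot term
    through [s j.+1]. *)
Lemma alive_huber_le : alive N * huber (s N) <=
  \sum_(j < N) (alive j * clip (sstop j) * incr j + overshoot j * s j.+1)
  + 2 * K * m.
Proof.
apply: (@le_trans _ _ (huber (sstop N))).
  have := huber_ge0 (sstop N).
  case: (alive_spec N) => [[h _]|->]; last by rewrite mul0r.
  by rewrite h mul1r sstop_alive.
apply: (le_trans (huber_sstop N)).
rewrite !big_split/= -addrA lerD2l.
have -> : 2 * K * m = K * m + K * m by ring.
apply: (@le_trans _ _ (\sum_(j < N) (overshoot j * s j.+1 +
    (alive j.+1 * `|incr j| * m + (alive j - alive j.+1) * (K * m))))).
  apply: ler_sum => j _.
  have hm := ltm (ltn_ord j); have t0 := trunc_incr_ge0 j.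
  have hn := alive_nincr j.
  rewrite /overshoot -[_ * Num.sg _ * _]mulrA -normrEsg.
  case: (alive_spec j) => [[aj sj]|aj]; last first.
    have -> : alive j.+1 = 0.
      case: (alive_spec j.+1) => [[aj1 _]|//].
      by rewrite aj aj1 in hn; lra.
    by rewrite aj; lra.
  case: (alive_spec j.+1) => [[-> _]|->]; rewrite aj.
    have : 0 <= `|incr j| * (m - trunc_incr j) by rewrite mulr_ge0 ?subr_ge0.
    lra.
  (* The crossing increment: [s j] is still bounded by the variation up to [j], hence by [K]. *)
  have : `|incr j| <= `|s j.+1| + K.
    rewrite (le_trans (ler_normB _ _))// lerD2l.
    exact: le_trans (norm_le_svar _) sj.
  move=> h.
  have : 0 <= (`|s j.+1| + K - `|incr j|) * trunc_incr j.
    by rewrite mulr_ge0// subr_ge0.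
  have : 0 <= K * (m - trunc_incr j) by rewrite mulr_ge0// subr_ge0.
  lra.
rewrite !big_split/= lerD2l -!mulr_suml lerD//.
  by rewrite ler_wpM2r// sum_alive_incr.
by rewrite sum_alive_drop ler_piMl ?alive_drop_le1// mulr_ge0.
Qed.

(** [alive] drops at most once, so at most one term is nonzero. *)
Lemma norm_sum_overshoot_le : `|\sum_(j < N) overshoot j| <= m.
Proof.
apply: (le_trans (ler_norm_sum _ _ _)).
apply: (@le_trans _ _ (\sum_(j < N) (alive j - alive j.+1) * m)).
  apply: ler_sum => j _; have an := alive_nincr j.
  rewrite /overshoot !normrM ger0_norm ?subr_ge0//.
  rewrite (ger0_norm (trunc_incr_ge0 _)) -mulrA ler_wpM2l ?subr_ge0//.
  rewrite (le_trans _ (ltm (ltn_ord j)))// ler_piMr ?trunc_incr_ge0//.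
  by rewrite normr_sg; case: (_ == 0).
by rewrite -mulr_suml sum_alive_drop ler_piMl// alive_drop_le1.
Qed.

End StoppedSequence.

Section MeasurableReal.
Context {R : realType}.

Lemma measurable_clip : measurable_fun setT (@clip R).
Proof.
by apply: measurable_maxr => //; apply: measurable_minr.
Qed.

Lemma measurable_huber : measurable_fun setT (@huber R).
Proof.
apply: measurable_funB; first by apply: measurable_funM => //; exact: measurable_clip.
apply: measurable_funM => //; apply: measurable_funX; exact: measurable_clip.
Qed.

Lemma measurable_sg : measurable_fun setT (@Num.sg R).
Proof.
rewrite (_ : Num.sg = (fun x : R => \1_`]0, +oo[%classic x - \1_`]-oo, 0[%classic x)).
  by apply: measurable_funB; exact: measurable_indic.
apply/funext => x; rewrite !indicE !mem_setE !in_itv/= andbT.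
by have [h|h|->] := ltrgtP x 0; rewrite ?(ltr0_sg h) ?(gtr0_sg h) ?sgr0/=; lra.
Qed.

End MeasurableReal.

(** * The estimate in expectation for a discrete martingale *)

Section DiscreteMartingale.
Context {R : realType} {d : measure_display} {T : measurableType d}.
Variables (P : probability T R) (G : nat -> set (set T)) (S : nat -> T -> R).
Hypothesis sG : forall i, sigma_algebra setT (G i).
Hypothesis Gm : forall i, G i `<=` measurable.
Hypothesis Gmono : forall i j, (i <= j)%N -> G i `<=` G j.
Hypothesis Smeas : forall i, smeas (G i) (S i).
Hypothesis Sint : forall i, rint P (S i).
Hypothesis Smart : forall i j, (i <= j)%N -> forall A, G i A ->
  \int[P]_(w in A) S j w = \int[P]_(w in A) S i w.
Hypothesis S0 : forall w, S 0%N w = 0.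
Variables (K : R) (m : T -> R) (N : nat).
Hypothesis K0 : 0 <= K.
Hypothesis mm : measurable_fun setT m.
Hypothesis m0 : forall w, 0 <= m w.
Hypothesis m2 : forall w, m w <= 2.
Hypothesis ltm : forall w j, (j < N)%N -> trunc_incr (S ^~ w) j <= m w.

Local Notation "'mf' i h" := (measurable_fun setT (h : g_sigma_algebraType (G i) -> R))
  (at level 10, i at next level, h at next level).

Let mS i j : (i <= j)%N -> mf j (S i).
Proof.
by move=> ij; apply/smeasP => // B mB; apply: (Gmono ij); exact: Smeas.
Qed.

Let mincr i j : (i < j)%N -> mf j (fun w => incr (S ^~ w) i).
Proof. by move=> ij; apply: measurable_funB; apply: mS => //; exact: ltnW. Qed.

Let malive i j : (i <= j)%N -> mf j (fun w => alive (S ^~ w) K i).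
Proof.
move=> ij; rewrite (_ : (fun _ => _) =
    \1_`]-oo, K]%classic \o (fun w => svar (S ^~ w) i)); last first.
  apply/funext => w /=; rewrite indicE /alive; congr (nat_of_bool _)%:R.
  by rewrite mem_setE in_itv.
apply: measurableT_comp; first exact: measurable_indic.
have -> : (fun w => svar (S ^~ w) i) =
    (fun w => \sum_(k <- index_enum 'I_i) `|incr (S ^~ w) k|) by [].
apply: measurable_sum => k; apply: measurableT_comp => //.
by apply: mincr; exact: leq_trans ij.
Qed.

Let msstop i : mf i (fun w => sstop (S ^~ w) K i).
Proof.
have -> : (fun w => sstop (S ^~ w) K i) = (fun w => \sum_(k <- index_enum 'I_i)
  alive (S ^~ w) K k * incr (S ^~ w) k) by [].
apply: measurable_sum => k; apply: measurable_funM.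
  by apply: malive; exact: ltnW.
exact: mincr.
Qed.

Let H1 j w := alive (S ^~ w) K j * clip (sstop (S ^~ w) K j).
Let H2 j w := overshoot (S ^~ w) K j.

Let mH1 j : smeas (G j) (H1 j).
Proof.
apply/smeasP => //; apply: measurable_funM; first exact: malive.
by apply: measurableT_comp => //; exact: measurable_clip.
Qed.

Let mH2 j : smeas (G j.+1) (H2 j).
Proof.
apply/smeasP => //; apply: measurable_funM.
  apply: measurable_funM; first by apply: measurable_funB; apply: malive.
  by apply: measurable_minr => //; apply: measurableT_comp => //; exact: mincr.
by apply: measurableT_comp; [exact: measurable_sg|exact: mS].
Qed.

Let alive01 w j : `|alive (S ^~ w) K j| <= 1.
Proof.
by case: (alive_spec (S ^~ w) K j) => [[-> _]|->]; rewrite ?normr1 ?normr0.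
Qed.

Let bH1 j w : `|H1 j w| <= 1.
Proof. by rewrite normrM mulr_ile1// clip_le1. Qed.

Let bH2 j w : `|H2 j w| <= 4.
Proof.
rewrite /H2 /overshoot 2!normrM.
have h1 : `|alive (S ^~ w) K j - alive (S ^~ w) K j.+1| <= 2.
  by rewrite (le_trans (ler_normB _ _))// (natrD _ 1 1) lerD.
have h2 : `|trunc_incr (S ^~ w) j| <= 2.
  by rewrite ger0_norm ?trunc_incr_ge0// /trunc_incr ge_min lexx orbT.
have h3 : `|Num.sg (S j.+1 w)| <= 1 by rewrite normr_sg; case: (_ == 0).
have -> : 4 = 2 * 2 * 1 :> R by ring.
by apply: ler_pM => //; apply: ler_pM.
Qed.

(** Both times are at or after [j], so [S i - S k] has integral 0 over every event of [G j]. It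
    serves to kill the transform by [H1] and to move the overshoot to time [N]. *)
Let Rint0 j i k H C : smeas (G j) H -> (forall w, `|H w| <= C) ->
  (j <= i)%N -> (j <= k)%N ->
  \int[P]_w (H w * (S i w - S k w)) = 0.
Proof.
move=> mH HC ji jk; apply: (Rintegral_mul_eq0 (sG j) (@Gm j) mH HC).
  exact: rintB.
move=> A GA; have mA := Gm GA.
rewrite RintegralB//; [|exact: integrableS (Sint i)|exact: integrableS (Sint k)].
by rewrite (Smart ji)// (Smart jk)// subrr.
Qed.

(* [H2 j] is bounded and known at time [j.+1], so [S j.+1] may be replaced by the
   fixed integrable variable [S N] in the overshoot terms. *)
Lemma discrete_bound :
  \int[P]_w (alive (S ^~ w) K N * huber (S N w)) <=
  2 * K * \int[P]_w m w + \int[P]_w (m w * `|S N w|).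
Proof.
have im : rint P m by apply: (@rint_bounded _ _ _ _ _ 2) => // w; rewrite ger0_norm.
have mH1' j : measurable_fun setT (H1 j) by exact: smeas_measurable (mH1 j).
have mH2' j : measurable_fun setT (H2 j) by exact: smeas_measurable (mH2 j).
have iH1 j X : rint P X -> rint P (fun w => H1 j w * X w).
  by move=> iX; exact: (rint_mul_bounded (mH1' j) (bH1 j)).
have iH2 j X : rint P X -> rint P (fun w => H2 j w * X w).
  by move=> iX; exact: (rint_mul_bounded (mH2' j) (bH2 j)).
have iincr j : rint P (fun w => incr (S ^~ w) j) by exact: rintB.
pose Z j w := H1 j w * incr (S ^~ w) j + H2 j w * S j.+1 w.
have iZ j : rint P (Z j) by apply: rintD; [exact: iH1|exact: iH2].
have imS : rint P (fun w => m w * `|S N w|).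
  apply: (@rint_mul_bounded _ _ _ _ _ _ 2) => //; last exact: rint_norm.
  by move=> w; rewrite ger0_norm.
have mal : measurable_fun setT (fun w => alive (S ^~ w) K N).
  apply: (smeas_measurable (@Gm N)); apply/smeasP => //; exact: malive.
apply: (@le_trans _ _ (\int[P]_w (\sum_(j < N) Z j w + 2 * K * m w))).
  apply: le_Rintegral => //.
  (* The linear growth of [huber] is used here: integrability of [S N] suffices. *)
  - apply: (@rint_le _ _ _ _ _ (S N)) => //.
      apply: measurable_funM => //; apply: measurableT_comp; first exact: measurable_huber.
      exact: rint_measurable (Sint N).
    move=> w; rewrite normrM (ger0_norm (huber_ge0 _)).
    rewrite (le_trans _ (huber_le_norm _))// ler_piMl ?huber_ge0//.
  - by apply: rintD; [exact: rint_sum|exact: rintZ].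
  - by move=> w _; apply: alive_huber_le => // j jN; exact: ltm.
rewrite RintegralD//; [|exact: rint_sum|exact: rintZ].
rewrite RintegralZl// addrC lerD2l Rintegral_sum_ord//.
have -> : \sum_(j < N) \int[P]_w Z j w =
    \int[P]_w (\sum_(j < N) H2 j w * S N w).
  rewrite (@Rintegral_sum_ord _ _ _ _ _ (fun j w => H2 j w * S N w)); last first.
    by move=> j _; exact: iH2.
  apply: eq_bigr => j _; rewrite /Z RintegralD//; [|exact: iH1|exact: iH2].
  have -> : \int[P]_w (H1 j w * incr (S ^~ w) j) = 0.
    by rewrite /incr; apply: (Rint0 (mH1 j) (bH1 j)).
  rewrite add0r; apply/eqP; rewrite -subr_eq0 -RintegralB//; [|exact: iH2..].
  apply/eqP; rewrite -[RHS](Rint0 (mH2 j) (bH2 j) (leqnn _) (ltn_ord j)).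
  by apply: eq_Rintegral => w _; rewrite mulrBr.
apply: le_Rintegral => //.
  by apply: (@rint_sum _ _ _ _ _ (fun j w => H2 j w * S N w)) => j _; exact: iH2.
move=> w _; rewrite -mulr_suml (le_trans (ler_norm _))// normrM ler_wpM2r//.
by apply: norm_sum_overshoot_le => // j jN; exact: ltm.
Qed.

End DiscreteMartingale.

(** * Refining the grid along a continuous martingale *)

Section UniformContinuity.
Context {R : realType}.
Implicit Types (A : set R) (f : R -> R).

Lemma within_continuous_dist A f x e : {within A, continuous f} -> A x -> 0 < e ->
  exists2 delta, 0 < delta &
    forall y, A y -> `|x - y| < delta -> `|f x - f y| < e.
Proof.
move=> /subspace_continuousP cf Ax e0.
have /cvgrPdist_lt /(_ e e0) := cf x Ax.
rewrite near_withinE => /nbhs_ballP[delta /= d0 h].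
by exists delta => // y Ay xy; apply: h.
Qed.

(** Heine's theorem with the mesh as modulus; compactness of [[0, t]] yields one rank [n] valid at
    all points. *)
Lemma heine_grid f t e : {within [set s | 0 <= s], continuous f} ->
  0 < e -> \forall n \near \oo, forall x y, 0 <= x <= t -> 0 <= y <= t ->
  `|x - y| <= t / n.+1%:R -> `|f x - f y| < e.
Proof.
move=> cf e0.
have [t0|t0] := ltP t 0.
  by apply: nearW => n x y; lra.
have /compact_near_coveringP/(_ _ (\oo) (fun n x => 0 <= x <= t ->
    forall y, 0 <= y <= t -> `|x - y| <= t / n.+1%:R -> `|f x - f y| < e)) :=
    @segment_compact _ 0 t.
move=> h; have {h} : \forall n \near \oo, `[0, t] `<=`
    (fun x => 0 <= x <= t ->
    forall y, 0 <= y <= t -> `|x - y| <= t / n.+1%:R -> `|f x - f y| < e).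
  apply: h => x; rewrite /= in_itv/= => x0t.
  have e20 : 0 < e / 2 by rewrite divr_gt0.
  have x0 : 0 <= x by case/andP: x0t.
  have [delta d0 hd] := within_continuous_dist cf x0 e20.
  (* Half of [delta] is spent on the distance from [x] to [z], half on the mesh, so that both [z]
     and [y] are within [delta] of [x]. *)
  have d20 : 0 < delta / 2 by rewrite divr_gt0.
  exists (ball x (delta / 2), [set n | t / n.+1%:R < delta / 2]) => /=.
    split; first exact: nbhsx_ballx.
    exists (Num.bound (t / (delta / 2))) => // n /= hn.
    rewrite ltr_pdivrMr// mulrC -ltr_pdivrMr//.
    apply: (lt_le_trans (archi_boundP _)); first by rewrite divr_ge0// ltW.
    by rewrite ler_nat (leq_trans hn).
  move=> [z n] /= [xz nd] z0t y y0t zy.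
  have h1 : `|x - z| < delta / 2 by exact: xz.
  have hz : `|f x - f z| < e / 2.
    by apply: hd; [case/andP: z0t|rewrite (lt_trans h1)// ltr_pdivrMr// ltr_pMr// ltr1n].
  have hy : `|f x - f y| < e / 2.
    apply: hd; first by case/andP: y0t.
    have -> : x - y = (x - z) + (z - y) by ring.
    have zyd := le_lt_trans zy nd.
    by rewrite (le_lt_trans (ler_normD _ _))// [ltRHS]splitr ltrD.
  have -> : f z - f y = (f x - f y) - (f x - f z) by ring.
  by rewrite (le_lt_trans (ler_normB _ _))// [ltRHS]splitr ltrD.
apply: filterS => n h x y x0t y0t; apply: h => //.
Qed.

End UniformContinuity.

Section RealIntegrals.
Context {R : realType} {d : measure_display} {T : measurableType d}.
Variables (P : probability T R).
Implicit Types (X Y : T -> R).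

Lemma Rintegral_le0_ae_eq0 X : rint P X -> (forall w, 0 <= X w) ->
  \int[P]_w X w <= 0 -> {ae P, forall w, X w = 0}.
Proof.
move=> iX X0 iX0.
have : (\int[P]_w `|(EFin \o X) w| = 0)%E.
  under eq_integral do rewrite /= ger0_norm//.
  have := integrable_fin_num measurableT iX => /fineK <-.
  congr (_%:E); apply/eqP; rewrite eq_le; apply/andP; split => //.
  exact: Rintegral_ge0.
move/(ae_eq_integral_abs _ measurableT (measurable_int _ iX)).
by apply: filterS => w /(_ I) /= [].
Qed.

Lemma Rintegral_cvg0 (X : nat -> T -> R) Y :
  (forall n, measurable_fun setT (X n)) -> rint P Y ->
  (forall n w, `|X n w| <= Y w) -> (forall w, X n w @[n --> \oo] --> 0) ->
  \int[P]_w X n w @[n --> \oo] --> 0.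
Proof.
move=> mX iY XY X0.
have [|||//||_ _] := @dominated_convergence _ _ _ P setT measurableT
  (fun n => EFin \o X n) (cst 0%E) (EFin \o Y).
- by move=> n; exact/measurable_EFinP.
- exact: measurable_cst.
- by apply: aeW => w _; apply: cvg_EFin; [exact: nearW|exact: X0].
- by apply: aeW => w n _; rewrite /= lee_fin.
rewrite integral0 => h; exact: (fine_cvg h).
Qed.

End RealIntegrals.

Lemma measurable_bigmax_ord {R : realType} {d : measure_display}
    {T : measurableType d} (n : nat) (h : nat -> T -> R) :
  (forall j, measurable_fun setT (h j)) ->
  measurable_fun setT (fun w => \big[Num.max/0]_(j < n) h j w).
Proof.
elim: n h => [|n ih] h mh.
  by rewrite (_ : (fun _ => _) = cst 0)//; apply/funext => w; rewrite big_ord0.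
rewrite (_ : (fun _ => _) = fun w => Num.max (h 0%N w)
    (\big[Num.max/0]_(j < n) h j.+1 w)); last first.
  by apply/funext => w; rewrite big_ord_recl.
by apply: measurable_maxr; [exact: mh|exact: (ih (fun j => h j.+1))].
Qed.

Section ContinuousMartingale.
Context {R : realType} {d : measure_display} {T : measurableType d}.
Variables (P : probability T R) (F : R -> set (set T)) (S : R -> T -> R).
Hypotheses (hF : usual_filtration P F) (hS : martingale P F S).
Hypotheses (cS : continuous_paths S) (S0 : forall w, S 0 w = 0).
Variable t : R.
Hypothesis t0 : 0 <= t.

Definition grid (k i : nat) : R := t * i%:R / k.+1%:R.

Lemma grid_ge0 k i : 0 <= grid k i.
Proof. by rewrite divr_ge0// mulr_ge0. Qed.

Lemma grid0 k : grid k 0 = 0.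
Proof. by rewrite /grid mulr0 mul0r. Qed.

Lemma grid_le k i j : (i <= j)%N -> grid k i <= grid k j.
Proof. by move=> ij; rewrite ler_wpM2r// ler_wpM2l// ler_nat. Qed.

Lemma grid_last k : grid k k.+1 = t.
Proof. by rewrite /grid mulfK// pnatr_eq0. Qed.

Lemma gridB k i : grid k i.+1 - grid k i = t / k.+1%:R.
Proof. by rewrite /grid -mulrBl -mulrBr -natr1 addrAC subrr add0r mulr1. Qed.

Definition grid_path k w : nat -> R := fun i => S (grid k i) w.

(** Thanks to the cut-off in [trunc_incr] this is at most 2, so dominated convergence applies
    without any integrability of the supremum of the path. *)
Definition mesh_incr k w : R :=
  \big[Num.max/0]_(j < k.+1) trunc_incr (grid_path k w) j.

Let mSt u : 0 <= u -> measurable_fun setT (S u).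
Proof.
by move=> u0; exact: rint_measurable (martingale_integrable hS u0).
Qed.

Lemma measurable_mesh_incr k : measurable_fun setT (mesh_incr k).
Proof.
apply: (@measurable_bigmax_ord _ _ _ k.+1
  (fun j w => trunc_incr (grid_path k w) j)) => j.
apply: measurable_minr => //.
apply: measurableT_comp => //; apply: measurable_funB; apply: mSt;
  exact: grid_ge0.
Qed.

Lemma mesh_incr_ge k w j : (j < k.+1)%N ->
  trunc_incr (grid_path k w) j <= mesh_incr k w.
Proof. by move=> jk; exact: (le_bigmax _ _ (Ordinal jk)). Qed.

Lemma mesh_incr_ge0 k w : 0 <= mesh_incr k w.
Proof. exact: le_trans (trunc_incr_ge0 _ _) (@mesh_incr_ge k w 0 _). Qed.

Lemma mesh_incr_le2 k w : mesh_incr k w <= 2.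
Proof.
by apply: bigmax_le => // j _; rewrite /trunc_incr ge_min lexx orbT.
Qed.

Lemma mesh_incr_cvg0 w : mesh_incr k w @[k --> \oo] --> 0.
Proof.
apply/cvgrPdist_lt => e e0.
have := heine_grid t (@cS w) e0; apply: filterS => k h.
rewrite sub0r normrN ger0_norm ?mesh_incr_ge0//.
apply: bigmax_lt => // j _; rewrite /trunc_incr gt_min; apply/orP; left.
have le_t i : (i <= k.+1)%N -> 0 <= grid k i <= t.
  by move=> ik; rewrite grid_ge0/= -(grid_last k) grid_le.
rewrite /incr; apply: h; [exact: le_t|by apply: le_t; exact: ltnW|].
by rewrite gridB ger0_norm// divr_ge0.
Qed.

(** One bound for all grids: the event does not change while the mesh tends to 0, and it is
    measurable as a countable intersection. *)
Definition bounded_grid_variation (K : R) : set T :=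
  [set w | forall k, svar (grid_path k w) k.+1 <= K].

Let mbgv K : measurable (bounded_grid_variation K).
Proof.
rewrite (_ : bounded_grid_variation K = \bigcap_k
  (fun w => svar (grid_path k w) k.+1) @^-1` `]-oo, K]); last first.
  apply/seteqP; split=> w /= h k; first by move=> _ /=; rewrite in_itv/=.
  by have := h k I; rewrite /= in_itv/=.
apply: bigcapT_measurable => k; rewrite -[X in measurable X]setTI.
have : measurable_fun setT (fun w => \sum_(i <- index_enum 'I_k.+1)
    `|incr (grid_path k w) i|).
  apply: measurable_sum => i; apply: measurableT_comp => //.
  by apply: measurable_funB; apply: mSt; exact: grid_ge0.
by apply => //; exact: measurable_itv.
Qed.

(** [discrete_bound] on the grid of index [k]; on the event [bounded_grid_variation K] the sequence
    is still alive at its last point. *)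
Lemma martingale_grid_bound K k : 0 <= K ->
  \int[P]_w (\1_(bounded_grid_variation K) w * huber (S t w)) <=
  \int[P]_w ((2 * K) * mesh_incr k w + mesh_incr k w * `|S t w|).
Proof.
move=> K0.
have iS u : 0 <= u -> rint P (S u) by exact: (martingale_integrable hS).
have g0 := grid_ge0 k.
have mm := measurable_mesh_incr k.
have im : rint P (mesh_incr k).
  apply: (@rint_bounded _ _ _ _ _ 2) => // w.
  by rewrite ger0_norm ?mesh_incr_ge0 ?mesh_incr_le2.
have imS : rint P (fun w => mesh_incr k w * `|S t w|).
  apply: (@rint_mul_bounded _ _ _ _ _ _ 2) => //; last exact/rint_norm/iS.
  by move=> w; rewrite ger0_norm ?mesh_incr_ge0 ?mesh_incr_le2.
rewrite RintegralD ?RintegralZl//; last exact: rintZ.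
have := @discrete_bound _ _ _ P (fun i => F (grid k i))
  (fun i => S (grid k i)) _ _ _ _ _ _ _ K (mesh_incr k) k.+1 K0 mm
  (mesh_incr_ge0 k) (mesh_incr_le2 k) (fun w j => @mesh_incr_ge k w j).
rewrite grid_last => bnd; apply: le_trans (bnd _ _ _ _ _ _ _).
- have mh : measurable_fun setT (fun w => huber (S t w)).
    by apply: measurableT_comp; [exact: measurable_huber|exact: mSt].
  have ih : rint P (fun w => huber (S t w)).
    apply: (@rint_le _ _ _ _ _ (S t)) => // [|w]; first exact: iS.
    by rewrite (ger0_norm (huber_ge0 _)) huber_le_norm.
  have mal : measurable_fun setT (fun w => alive (grid_path k w) K k.+1).
    rewrite (_ : (fun _ => _) = \1_`]-oo, K]%classic \o
        (fun w => svar (grid_path k w) k.+1)); last first.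
      apply/funext => w /=; rewrite indicE /alive; congr (nat_of_bool _)%:R.
      by rewrite mem_setE in_itv.
    apply: measurableT_comp; first exact: measurable_indic.
    have -> : (fun w => svar (grid_path k w) k.+1) = (fun w =>
      \sum_(i <- index_enum 'I_k.+1) `|incr (grid_path k w) i|) by [].
    apply: measurable_sum => i; apply: measurableT_comp => //.
    by apply: measurable_funB; apply: mSt; exact: grid_ge0.
  apply: le_Rintegral => //.
  + exact: rint_indicM.
  + apply: (@rint_mul_bounded _ _ _ _ _ _ 1) => // w.
    by case: (alive_spec (grid_path k w) K k.+1) => [[-> _]|->];
      rewrite ?normr1 ?normr0.
  + move=> w _; rewrite ler_wpM2r ?huber_ge0// indicE /alive ler_nat.
    case: (boolP (w \in _)) => // /set_mem /(_ k).
    by rewrite /grid_path => ->.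
- by move=> i; exact: (filtration_sigma hF (g0 i)).
- by move=> i; exact: (filtration_sub hF (g0 i)).
- by move=> i j ij; exact: (filtration_mono hF (g0 i) (grid_le k ij)).
- by move=> i B mB; exact: (martingale_adapted hS (g0 i)).
- by move=> i; exact: iS.
- move=> i j ij A FA; congr fine.
  exact: (martingale_condexp hS (g0 i) (grid_le k ij) FA).
- by move=> w; rewrite grid0.
Qed.

(** As [k] grows, [martingale_grid_bound] makes the mean of [huber (S t w)] over each event vanish;
    integers [K] cover all cases. The variation hypothesis is stated path by path because a
    localized process will satisfy it only on part of the space. *)
Lemma martingale_bounded_variation_eq0 : {ae P, forall w,
  (exists K, forall k, svar (grid_path k w) k.+1 <= K) -> S t w = 0}.
Proof.
have iS : rint P (S t) by exact: (martingale_integrable hS).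
have mh : measurable_fun setT (fun w => huber (S t w)).
  by apply: measurableT_comp; [exact: measurable_huber|exact: mSt].
have ih : rint P (fun w => huber (S t w)).
  apply: (@rint_le _ _ _ _ _ (S t)) => // w.
  by rewrite (ger0_norm (huber_ge0 _)) huber_le_norm.
have main K : 0 <= K ->
    {ae P, forall w, \1_(bounded_grid_variation K) w * huber (S t w) = 0}.
  move=> K0; apply: Rintegral_le0_ae_eq0; first exact: rint_indicM.
    by move=> w; rewrite mulr_ge0// huber_ge0.
  have cvg0 : \int[P]_w ((2 * K) * mesh_incr k w + mesh_incr k w * `|S t w|)
      @[k --> \oo] --> 0.
    apply: (@Rintegral_cvg0 _ _ _ _ _ (fun w => 2 * K * 2 + 2 * `|S t w|)).
    - move=> k; apply: measurable_funD; apply: measurable_funM => //;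
        [exact: measurable_mesh_incr|exact: measurable_mesh_incr|].
      by apply: measurableT_comp => //; exact: mSt.
    - by apply: rintD; [exact: rint_cst|apply/rintZ/rint_norm].
    - move=> k w; have h0 := mesh_incr_ge0 k w; have h2 := mesh_incr_le2 k w.
      rewrite ger0_norm; last by rewrite addr_ge0 ?mulr_ge0.
      by rewrite lerD// ?ler_wpM2l ?ler_wpM2r// mulr_ge0.
    - move=> w; have c := @mesh_incr_cvg0 w.
      rewrite -[X in _ --> X]addr0; apply: cvgD.
        by rewrite -(mulr0 (2 * K)); apply: cvgM => //; exact: cvg_cst.
      by rewrite -(mul0r `|S t w|); apply: cvgM => //; exact: cvg_cst.
  rewrite -(cvg_lim _ cvg0)//; apply: limr_ge; first by apply/cvg_ex; exists 0.
  by apply: nearW => k; exact: martingale_grid_bound.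
have : {ae P, forall w, forall n : nat,
    \1_(bounded_grid_variation n%:R) w * huber (S t w) = 0}.
  by apply: ae_foralln => n; exact: main.
apply: filterS => w h [K hK].
have Kn : K <= (Num.bound `|K|)%:R.
  by rewrite (le_trans (ler_norm _))// ltW// archi_boundP.
have := h (Num.bound `|K|); rewrite indicE mem_set ?mul1r; first exact: huber_eq0.
by move=> k; exact: le_trans Kn.
Qed.

End ContinuousMartingale.

(** * Local martingales of finite variation *)

Section MoreContinuity.
Context {R : realType}.
Implicit Types (A : set R) (f : R -> R).

Lemma dist_within_continuous A f :
  (forall x e, A x -> 0 < e -> exists2 delta, 0 < delta &
    forall y, A y -> `|x - y| < delta -> `|f x - f y| < e) ->
  {within A, continuous f}.
Proof.
move=> h; apply/subspace_continuousP => x Ax; apply/cvgrPdist_lt => e e0.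
have [delta d0 hd] := h x e Ax e0.
rewrite near_withinE; apply/nbhs_ballP; exists delta => // y xy Ay.
exact: hd.
Qed.

(** The grid is a partition of [[0, t]]. The cap by [t] acts only on indices beyond [k.+1] and keeps
    every point in [[0, t]], as [weak_local_martingale] asks. *)
Lemma grid_variation_le f t : 0 < t -> bounded_variation 0 t f ->
  exists K, forall k, svar (fun i => f (Num.min (grid t k i) t)) k.+1 <= K.
Proof.
move=> t0 [K hK]; exists K => k; apply: hK.
exists [seq grid t k i | i <- iota 1 k.+1].
  have step i : grid t k i < grid t k i.+1.
    by rewrite -subr_gt0 gridB divr_gt0.
  have path_grid n i : path <%R (grid t k i) [seq grid t k j | j <- iota i.+1 n].
    by elim: n i => //= n ih i; rewrite step ih.
  split; first by have := path_grid k.+1 0%N; rewrite grid0.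
  have -> : iota 1 k.+1 = rcons (iota 1 k) k.+1 by rewrite -cats1 -(iotaD 1 k 1) addn1.
  by rewrite map_rcons last_rcons grid_last.
rewrite /variation size_map size_iota big_mkord /svar; apply: eq_bigr => i _.
have nthE j : (j <= k.+1)%N ->
    nth t (0 :: [seq grid t k j | j <- iota 1 k.+1]) j = Num.min (grid t k j) t.
  move=> jk; rewrite min_l; last by rewrite -[leRHS](grid_last t k) grid_le// ltW.
  case: j jk => [_|j jk]; first by rewrite grid0.
  by rewrite /nth -/(nth _ _ _) (nth_map 0%N) ?size_iota// nth_iota// add1n.
by rewrite /incr -(nthE i.+1)// -(nthE i (ltnW (ltn_ord i))).
Qed.

End MoreContinuity.

Section LocalMartingales.
Context {R : realType} {d : measure_display} {T : measurableType d}.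
Variables (P : probability T R) (F : R -> set (set T)).
Hypothesis hF : usual_filtration P F.

Lemma Rintegral_martingale (M : R -> T -> R) : adapted F M ->
  (forall t, 0 <= t -> rint P (M t)) ->
  (forall s t, 0 <= s -> s <= t -> forall A, F s A ->
    \int[P]_(w in A) M t w = \int[P]_(w in A) M s w) ->
  martingale P F M.
Proof.
move=> aM iM hM; split => // s t s0 st A FA.
have mA : measurable A by exact: (filtration_sub hF s0 FA).
have t0 := le_trans s0 st.
have fin u : 0 <= u -> (\int[P]_(w in A) (M u w)%:E \is a fin_num)%E.
  by move=> u0; apply: integrable_fin_num => //; apply: integrableS (iM u u0).
by rewrite -(fineK (fin t t0)) -(fineK (fin s s0)); congr (_%:E); exact: hM.
Qed.

Lemma martingale_lin a b (M N : R -> T -> R) :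
  martingale P F M -> martingale P F N ->
  martingale P F (fun t w => a * M t w + b * N t w).
Proof.
move=> hM hN; apply: Rintegral_martingale.
- move=> t t0; apply/smeasP; first exact: (filtration_sigma hF t0).
  apply: measurable_funD; apply: measurable_funM => //.
    by apply/smeasP; [exact: (filtration_sigma hF t0)|exact: (martingale_adapted hM t0)].
  by apply/smeasP; [exact: (filtration_sigma hF t0)|exact: (martingale_adapted hN t0)].
- by move=> t t0; apply: rintD; apply: rintZ;
    [exact: (martingale_integrable hM t0)|exact: (martingale_integrable hN t0)].
- move=> s t s0 st A FA; have t0 := le_trans s0 st.
  have mA : measurable A by exact: (filtration_sub hF s0 FA).
  have iM u : 0 <= u -> P.-integrable A (EFin \o M u).
    by move=> u0; apply: (integrableS _ _ _ (martingale_integrable hM u0)).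
  have iN u : 0 <= u -> P.-integrable A (EFin \o N u).
    by move=> u0; apply: (integrableS _ _ _ (martingale_integrable hN u0)).
  have iZ c X : P.-integrable A (EFin \o X) ->
      P.-integrable A (EFin \o (fun w => c * X w)).
    by move=> iX; exact: (integrableZl mA c iX).
  rewrite !RintegralD//; [|exact/iZ/iM|exact/iZ/iN|exact/iZ/iM|exact/iZ/iN].
  rewrite !RintegralZl//; [|exact: iN|exact: iM|exact: iN|exact: iM].
  rewrite /Rintegral (martingale_condexp hM s0 st FA).
  by rewrite (martingale_condexp hN s0 st FA).
Qed.

(* Unlike [local_martingale], this notion is stable under linear combinations
   without any optional stopping theorem: the two localizing sequences need not be
   merged. *)
Definition weak_local_martingale (Z : R -> T -> R) :=
  exists S : nat -> R -> T -> R,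
    (forall n, [/\ martingale P F (S n), continuous_paths (S n) &
                   forall w, S n 0 w = 0]) /\
    forall (t : R) (u : nat -> nat -> R), (forall i j, 0 <= u i j <= t) ->
      {ae P, forall w, \forall n \near \oo,
        forall i j, S n (u i j) w = Z (u i j) w}.

Lemma weak_local_martingale_lin a b Z Z' :
  weak_local_martingale Z -> weak_local_martingale Z' ->
  weak_local_martingale (fun t w => a * Z t w + b * Z' t w).
Proof.
move=> [S [hS SZ]] [S' [hS' SZ']].
exists (fun n t w => a * S n t w + b * S' n t w); split.
  move=> n; have [mS cS S0] := hS n; have [mS' cS' S'0] := hS' n; split.
  - exact: martingale_lin.
  - by move=> w x; apply: cvgD; apply: cvgM;
      [exact: cvg_cst|exact: cS|exact: cvg_cst|exact: cS'].
  - by move=> w; rewrite S0 S'0 !mulr0 addr0.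
move=> t u ut.
apply: filterS2 (SZ t u ut) (SZ' t u ut) => w; apply: filterS2 => n h h' i j.
by rewrite h h'.
Qed.

(** This is what the doubly indexed family of times in the definition is for: equalities at each
    fixed time combine over countably many times into one null set. *)
Lemma weak_local_martingale_ae_eq Z Z' :
  (forall t, 0 <= t -> {ae P, forall w, Z t w = Z' t w}) ->
  weak_local_martingale Z -> weak_local_martingale Z'.
Proof.
move=> ZZ' [S [hS SZ]]; exists S; split => // t u ut.
have h : {ae P, forall w, forall i j, Z (u i j) w = Z' (u i j) w}.
  apply: ae_foralln => i; apply: ae_foralln => j; apply: ZZ'.
  by case/andP: (ut i j).
apply: filterS2 h (SZ t u ut) => w hw; apply: filterS => n hn i j.
by rewrite hn hw.
Qed.

(** Capping time at [tau w] is 1-Lipschitz, so the same [delta] works. *)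
Lemma stopped_continuous (M : R -> T -> R) (tau : T -> \bar R) :
  (forall w, (0 <= tau w)%E) -> continuous_paths M ->
  continuous_paths (stopped M tau).
Proof.
move=> tau0 cM w; apply: dist_within_continuous => x e x0 e0.
have ge0 y : 0 <= y -> 0 <= fine (mine y%:E (tau w)).
  by move=> y0; rewrite fine_ge0// le_min lee_fin y0 tau0.
have [delta d0 hd] := within_continuous_dist (cM w) (ge0 x x0) e0.
exists delta => // y y0 xy; apply: hd; first exact: ge0.
apply: le_lt_trans xy; case: (tau w) (tau0 w) => [r r0||//].
  rewrite -!EFin_min/= ler_norml; have := ler_norm (x - y).
  have := ler_norm (- (x - y)); rewrite normrN /Num.min.
  by case: (ltP x r) => ?; case: (ltP y r) => ?; lra.
by rewrite !min_l ?leey.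
Qed.

(** Once [tau n] exceeds [t], stopping changes nothing on [[0, t]]. *)
Lemma local_martingale_weak (M : R -> T -> R) : local_martingale P F M ->
  continuous_paths M -> (forall w, M 0 w = 0) -> weak_local_martingale M.
Proof.
move=> [aM [tau [stau _ tauoo mtau]]] cM M0.
have tau0 n w : (0 <= tau n w)%E := stopping_time_ge0 (stau n) w.
exists (fun n => stopped M (tau n)); split.
  move=> n; split; [exact: mtau|exact: stopped_continuous|].
  by move=> w; rewrite /stopped min_l.
move=> t u ut; apply: filterS tauoo => w /cvgeyPgt/(_ t).
apply: filterS => n tn i j; rewrite /stopped min_l//.
by rewrite (le_trans _ (ltW tn))// lee_fin; case/andP: (ut i j).
Qed.

(** For almost every path some [S n] agrees with [Z] at all points of all grids of [[0, t]], so it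
    inherits the bound on grid variations and vanishes at [t]. *)
Lemma weak_local_martingale_bounded_variation_eq0 Z : weak_local_martingale Z ->
  (forall t w, 0 < t -> bounded_variation 0 t (Z ^~ w)) ->
  forall t, 0 <= t -> {ae P, forall w, Z t w = 0}.
Proof.
move=> [S [hS SZ]] bvZ t t0.
pose u k i : R := Num.min (grid t k i) t.
have u0t k i : 0 <= u k i <= t.
  by rewrite /u le_min grid_ge0//= t0 ge_min lexx orbT.
have ult k i : (i <= k.+1)%N -> u k i = grid t k i.
  by move=> ik; rewrite /u min_l// -[leRHS](grid_last t k) grid_le.
have ae1 : {ae P, forall w, forall n,
    (exists K, forall k, svar (grid_path (S n) t k w) k.+1 <= K) -> S n t w = 0}.
  apply: ae_foralln => n; have [mS cS S0] := hS n.
  exact: (martingale_bounded_variation_eq0 hF).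
apply: filterS2 ae1 (SZ t u u0t) => w hw [n0 _ hn].
have {}hn := hn n0 (leqnn n0).
have Zt : S n0 t w = Z t w.
  (* The grid of index 0 has a single step, so its point of index 1 is [t] itself. *)
  by have := hn 0%N 1%N; rewrite ult// grid_last.
rewrite -Zt; move: t0; rewrite le_eqVlt => /predU1P[<-|t0].
  by have [_ _] := hS n0; exact.
apply: hw; have [K hK] := grid_variation_le t0 (bvZ t w t0).
exists K => k; apply: le_trans (hK k).
apply: ler_sum => i _; rewrite /incr /grid_path.
have ik : (i <= k.+1)%N by exact/ltnW/ltn_ord.
have SE j : (j <= k.+1)%N -> S n0 (grid t k j) w = Z (Num.min (grid t k j) t) w.
  by move=> jk; rewrite -[RHS]hn ult.
by rewrite !SE.
Qed.

End LocalMartingales.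

(** * Uniqueness and polarization of characteristics; exponentials are solutions *)

Section Characteristics.
Context {R : realType} {d : measure_display} {T : measurableType d}.
Variables (P : probability T R) (F : R -> set (set T)).
Hypothesis hF : usual_filtration P F.
Implicit Types (X Y M N L Q : R -> T -> R).

Lemma clm_weak M : continuous_local_martingale0 P F M ->
  weak_local_martingale P F M.
Proof. by case=> lM cM M0; exact: local_martingale_weak. Qed.

(** [M - N = B - A] is a weak local martingale with paths of bounded variation. *)
Lemma martingale_part_unique X M N :
  martingale_part P F X M -> martingale_part P F X N ->
  forall t, 0 <= t -> {ae P, forall w, M t w = N t w}.
Proof.
move=> [cM [A cA XMA]] [cN [B cB XNB]] t t0.
have := weak_local_martingale_lin hF 1 (-1) (clm_weak cM) (clm_weak cN).
move/(@weak_local_martingale_ae_eq _ _ _ _ _ _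
  (fun t w => B t w + - A t w)) => /(_ _)/wrap[].
  move=> s s0; apply: aeW => w.
  by have := XMA s w s0; rewrite (XNB s w s0); lra.
move/(weak_local_martingale_bounded_variation_eq0 hF) => /(_ _ _ t0)/wrap[].
  move=> s w s0; apply: bounded_variationD => //.
    exact: (cfv_finite_variation cB w (ltW s0)).
  by apply: bounded_variationN; exact: (cfv_finite_variation cA w (ltW s0)).
apply: filterS => w BA.
by have := XMA t w t0; rewrite (XNB t w t0); lra.
Qed.

Lemma martingale_partD X Y M N : martingale_part P F X M ->
  martingale_part P F Y N ->
  forall L, martingale_part P F (fun t w => X t w + Y t w) L ->
  forall t, 0 <= t -> {ae P, forall w, L t w = M t w + N t w}.
Proof.
move=> [cM [A cA XMA]] [cN [B cB YNB]] L [cL [C cC XYLC]] t t0.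
have h := weak_local_martingale_lin hF 1 1 (clm_weak cM) (clm_weak cN).
have := weak_local_martingale_lin hF 1 (-1) (clm_weak cL) h.
move/(@weak_local_martingale_ae_eq _ _ _ _ _ _
  (fun t w => A t w + B t w + - C t w)) => /(_ _)/wrap[].
  move=> s s0; apply: aeW => w.
  by have := XYLC s w s0; rewrite (XMA s w s0) (YNB s w s0); lra.
move/(weak_local_martingale_bounded_variation_eq0 hF) => /(_ _ _ t0)/wrap[].
  move=> s w s0; have s0' := ltW s0.
  apply: bounded_variationD => //; first apply: bounded_variationD => //.
  - exact: (cfv_finite_variation cA w s0').
  - exact: (cfv_finite_variation cB w s0').
  - by apply: bounded_variationN; exact: (cfv_finite_variation cC w s0').
apply: filterS => w.
by have := XYLC t w t0; rewrite (XMA t w t0) (YNB t w t0); lra.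
Qed.

Lemma square_compensated_weak M Q : continuous_paths M -> (forall w, M 0 w = 0) ->
  continuous_paths Q -> (forall w, Q 0 w = 0) ->
  local_martingale P F (fun t w => M t w ^+ 2 - Q t w) ->
  weak_local_martingale P F (fun t w => M t w ^+ 2 - Q t w).
Proof.
move=> cM M0 cQ Q0 lMQ; apply: local_martingale_weak => //.
  move=> w x; apply: cvgB; last exact: cQ.
  by apply: cvgM; exact: cM.
by move=> w; rewrite M0 Q0 expr0n/= subr0.
Qed.

(** Polarization: with [L = M + N], the sum of the compensated squares of [M] and [N] and twice the
    compensated product, minus the compensated square of [L], leaves only the characteristics. It is
    a weak local martingale of bounded variation. *)
Lemma square_characteristicD X Y QX QY QXY QS :
  square_characteristic P F X QX -> square_characteristic P F Y QY ->
  mutual_characteristic P F X Y QXY ->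
  square_characteristic P F (fun t w => X t w + Y t w) QS ->
  forall t, 0 <= t ->
    {ae P, forall w, QS t w = QX t w + QY t w + 2 * QXY t w}.
Proof.
move=> [M pM [_ cQX ndQX QX0 lX]] [N pN [_ cQY ndQY QY0 lY]].
move=> [M' [N' [pM' pN' cQXY lXY]]] [L pL [_ cQS ndQS QS0 lS]] t t0.
have wX := square_compensated_weak (clm_continuous pM.1) (clm_0 pM.1) cQX QX0 lX.
have wY := square_compensated_weak (clm_continuous pN.1) (clm_0 pN.1) cQY QY0 lY.
have wS := square_compensated_weak (clm_continuous pL.1) (clm_0 pL.1) cQS QS0 lS.
have wXY : weak_local_martingale P F (fun t w => M' t w * N' t w - QXY t w).
  apply: local_martingale_weak => //.
    move=> w x; apply: cvgB; last exact: (cfv_continuous cQXY).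
    by apply: cvgM; [exact: (clm_continuous pM'.1)|exact: (clm_continuous pN'.1)].
  by move=> w; rewrite (clm_0 pM'.1) mul0r (cfv_0 cQXY) subr0.
have w1 := weak_local_martingale_lin hF 1 1 wX wY.
have w2 := weak_local_martingale_lin hF 1 2 w1 wXY.
have := weak_local_martingale_lin hF 1 (-1) w2 wS.
move/(@weak_local_martingale_ae_eq _ _ _ _ _ _
  (fun t w => QS t w + - QX t w + - QY t w + - QXY t w + - QXY t w)).
move=> /(_ _)/wrap[].
  move=> s s0.
  (* The mutual characteristic comes with its own martingale parts, which are identified with those
     of the square characteristics. *)
  have hM := martingale_part_unique pM pM' s0.
  have hN := martingale_part_unique pN pN' s0.
  have hL := martingale_partD pM pN pL s0.
  apply: filterS3 hM hN hL => w <- <- ->; ring.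
move/(weak_local_martingale_bounded_variation_eq0 hF) => /(_ _ _ t0)/wrap[].
  move=> s w s0; have s0' := ltW s0.
  have ndbv Q : nondecreasing_paths Q -> bounded_variation 0 s (Q ^~ w).
    move=> ndQ; apply: nondecreasing_bounded_variation => x y.
    by rewrite !in_itv/= => /andP[x0 _] _ xy; exact: ndQ.
  apply: bounded_variationD => //; first apply: bounded_variationD => //;
    first apply: bounded_variationD => //; first apply: bounded_variationD => //.
  - exact: ndbv.
  - by apply: bounded_variationN; exact: ndbv.
  - by apply: bounded_variationN; exact: ndbv.
  - by apply: bounded_variationN; exact: (cfv_finite_variation cQXY w s0').
  - by apply: bounded_variationN; exact: (cfv_finite_variation cQXY w s0').
by apply: filterS => w h; lra.
Qed.

(** The term [k * QXY] added to the second argument cancels against the [2 * QXY] contained in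
    [<X + Y>]. Since [f] is known only for [u >= 0], the characteristics must be nonnegative. *)
Lemma exp_fun_solution (V : set (R -> T -> R)) k (f : R -> R -> R) :
  (forall u v : R, 0 <= u -> f u v = exp_fun k u v) -> solution P F V f.
Proof.
move=> fE X Y _ _ QX QY QXY QS hX hY hXY hS t t0.
have := square_characteristicD hX hY hXY hS t0.
have nneg Z Q w : square_characteristic P F Z Q -> 0 <= Q t w.
  by move=> [M _ [_ _ ndQ Q0 _]]; rewrite -(Q0 w) ndQ.
apply: filterS => w QSE; rewrite !fE; [|exact: nneg hS|exact: nneg hY|exact: nneg hX].
by rewrite /exp_fun -expRD QSE; congr expR; lra.
Qed.

End Characteristics.

(** * Brownian motion *)

Section UnboundedMultiplier.
Context {R : realType} {d : measure_display} {T : measurableType d}.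
Variables (P : probability T R).
Implicit Types (G : set (set T)) (H D : T -> R).

(** [H] is replaced by 0 where it exceeds [n] in absolute value; the error is dominated by [|H * D|]
    and tends to 0. *)
Lemma Rintegral_mul_integrable_eq0 G H D : sigma_algebra setT G ->
  G `<=` measurable -> smeas G H -> rint P D -> rint P (fun w => H w * D w) ->
  (forall A, G A -> \int[P]_(w in A) D w = 0) ->
  \int[P]_w (H w * D w) = 0.
Proof.
move=> sG Gm mGH iD iHD D0.
pose J (n : nat) : set R := `[- n%:R, n%:R]%classic.
pose K n w := \1_(J n) (H w) * H w.
have mJ n : measurable (J n) by exact: measurable_itv.
have mGK n : smeas G (K n).
  apply/smeasP => //; have mH := (smeasP H sG).1 mGH.
  by apply: measurable_funM => //; apply: measurableT_comp.
have KE n w : K n w = if `|H w| <= n%:R then H w else 0.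
  rewrite /K indicE mem_setE in_itv/= -ler_norml.
  by case: ifP; rewrite ?mul1r ?mul0r.
have bK n w : `|K n w| <= n%:R by rewrite KE; case: ifP; rewrite ?normr0.
have KD0 n : \int[P]_w (K n w * D w) = 0.
  exact: (Rintegral_mul_eq0 sG Gm (mGK n) (bK n) iD D0).
have iKD n : rint P (fun w => K n w * D w).
  by apply: (rint_mul_bounded _ (bK n)) => //; exact: smeas_measurable (mGK n).
have cvg0 : \int[P]_w (H w * D w - K n w * D w) @[n --> \oo] --> 0.
  apply: (@Rintegral_cvg0 _ _ _ P _ (fun w => `|H w * D w|)).
  - by move=> n; apply: rint_measurable (rintB iHD (iKD n)).
  - exact: rint_norm.
  - move=> n w; rewrite KE; case: ifP => _; first by rewrite subrr normr0.
    by rewrite mul0r subr0.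
  - move=> w; apply: cvg_near_cst; exists (Num.bound `|H w|) => // n /= hn.
    rewrite KE ifT ?subrr// ltW// (lt_le_trans (archi_boundP _))//.
    by rewrite ler_nat.
have E n : \int[P]_w (H w * D w - K n w * D w) = \int[P]_w (H w * D w).
  by rewrite RintegralB//; [rewrite KD0 subr0|exact: iKD].
rewrite (funext E) in cvg0.
by apply: (cvg_unique _ _ cvg0) => //; exact: cvg_cst.
Qed.

(* Apply the previous lemma to [sigma(I)] and the variable [\1_A - P A]. *)
Lemma Rintegral_indep A (I : T -> R) (g : R -> R) : measurable A ->
  measurable_fun setT I -> measurable_fun setT g ->
  (forall B : set R, measurable B ->
    P (A `&` I @^-1` B) = (P A * P (I @^-1` B))%E) ->
  rint P (g \o I) ->
  \int[P]_(w in A) g (I w) = fine (P A) * \int[P]_w g (I w).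
Proof.
move=> mA mI mg indep igI.
pose G := preimage_set_system setT I measurable.
have sG : sigma_algebra setT G.
  by apply: sigma_algebra_preimage; exact: sigma_algebra_measurable.
have GE B : G B -> exists2 C, measurable C & B = I @^-1` C.
  by move=> [C mC <-]; exists C => //; rewrite setTI.
have Gm : G `<=` measurable.
  by move=> B /GE[C mC ->]; rewrite -[X in measurable X]setTI; exact: mI.
pose D w : R := \1_A w - fine (P A).
have i1A : rint P (\1_A : T -> R).
  apply: (@rint_bounded _ _ _ _ _ 1); first exact: measurable_indic.
  by move=> w; rewrite indicE; case: (_ \in _); rewrite ?normr1 ?normr0.
have iD : rint P D by apply: rintB => //; exact: rint_cst.
have i1 : rint P (fun w => \1_A w * g (I w)) by exact: rint_indicM.
have i2 : rint P (fun w => fine (P A) * g (I w)) by exact: rintZ.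
have E w : g (I w) * D w = \1_A w * g (I w) - fine (P A) * g (I w).
  by rewrite /D; ring.
have : \int[P]_w (g (I w) * D w) = 0.
  apply: (@Rintegral_mul_integrable_eq0 G (g \o I)) => //.
  - move=> B mB; exists (g @^-1` B); last by rewrite setTI.
    by rewrite -[X in measurable X]setTI; exact: mg.
  - by rewrite (funext E); exact: rintB.
  - move=> _ /GE[C mC ->].
    have mIC : measurable (I @^-1` C) by rewrite -[X in measurable X]setTI; exact: mI.
    rewrite /D RintegralB//; last 2 first.
    + exact: (integrableS _ _ _ i1A).
    + exact: finite_measure_integrable_cst.
    rewrite Rintegral_cst// /Rintegral integral_indic//.
    apply/eqP; rewrite subr_eq0 -fineM ?fin_num_measure//; apply/eqP.
    by congr fine; exact: indep.
rewrite (funext E) RintegralB// Rintegral_indicM// RintegralZl//.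
by move=> /eqP; rewrite subr_eq0 => /eqP.
Qed.

End UnboundedMultiplier.

(** * Moments and conditional moments of Brownian increments *)

Section BrownianIncrements.
Context {R : realType} {d : measure_display} {T : measurableType d}.
Variables (P : probability T R) (F : R -> set (set T)) (W : R -> T -> R).
Hypotheses (hF : usual_filtration P F) (hW : brownian_motion P F W).

Lemma smeas_brownian s t : 0 <= s -> s <= t -> smeas (F t) (W s).
Proof.
move=> s0 st B mB; apply: (filtration_mono hF s0 st).
exact: (bm_adapted hW s0).
Qed.

Lemma measurable_brownian t : 0 <= t -> measurable_fun setT (W t).
Proof.
move=> t0; apply: (smeas_measurable (filtration_sub hF t0)).
exact: smeas_brownian.
Qed.

Variables (p q : R).
Hypotheses (p0 : 0 <= p).
Let I w : R := W q w - W p w.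

Lemma measurable_increment : p <= q -> measurable_fun setT I.
Proof.
move=> pq; apply: measurable_funB; apply: measurable_brownian => //.
exact: le_trans pq.
Qed.

Lemma increment_shifted_moment a : p < q ->
  (\int[P]_w ((I w + a) ^+ 2)%:E = (q - p + a ^+ 2)%:E)%E.
Proof.
move=> pq; have mI := measurable_increment (ltW pq).
have sq : Num.sqrt (q - p) != 0 by rewrite gt_eqF// sqrtr_gt0 subr_gt0.
have := normal_shifted_moment sq a; rewrite sqr_sqrtr ?subr_ge0 ?(ltW pq)// => <-.
have mg : measurable_fun setT (fun x : R => ((x + a) ^+ 2)%:E).
  by apply/measurable_EFinP/measurable_funX/measurable_funD.
have mI' : measurable_fun setT (I : T -> measurableTypeR R) by exact: mI.
pose J : {mfun T >-> measurableTypeR R} :=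
  HB.pack I (isMeasurableFun.Build _ _ _ _ _ mI').
have <- : (\int[distribution P J]_x ((x + a) ^+ 2)%:E =
    \int[normal_prob 0 (Num.sqrt (q - p))]_x ((x + a) ^+ 2)%:E)%E.
  by apply: eq_measure_integral => B mB _; exact: (bm_gaussian hW p0 pq mB).
by rewrite ge0_integral_distribution// => x; rewrite lee_fin sqr_ge0.
Qed.

Lemma increment_second_moment : p < q ->
  (\int[P]_w (I w ^+ 2)%:E = (q - p)%:E)%E.
Proof.
move=> pq; have := increment_shifted_moment 0 pq; rewrite expr0n addr0 => <-.
by apply: eq_integral => w _; rewrite addr0.
Qed.

(** [bm_gaussian] speaks only of [p < q]; here and below [p = q] is treated apart, since windows
    also produce empty increments. *)
Lemma rint_increment_sqr : p <= q -> rint P (fun w => I w ^+ 2).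
Proof.
rewrite le_eqVlt => /predU1P[pq|pq].
  rewrite (_ : (fun w => _) = cst 0); first exact: rint_cst.
  by apply/funext => w; rewrite /I pq subrr expr0n.
apply/integrableP; split.
  by apply/measurable_EFinP/measurable_funX/measurable_increment/ltW.
under eq_integral do rewrite /= ger0_norm ?sqr_ge0//.
by rewrite /= increment_second_moment// ltry.
Qed.

Lemma rint_increment : p <= q -> rint P I.
Proof.
move=> pq; apply: (@rint_le _ _ _ _ _ (fun w => I w ^+ 2 + 1)).
- exact: measurable_increment.
- by apply: rintD; [exact: rint_increment_sqr|exact: rint_cst].
- move=> w; rewrite [leRHS]ger0_norm ?addr_ge0 ?sqr_ge0//.
  have e : `|I w| ^+ 2 = I w ^+ 2 by rewrite -normrX ger0_norm ?sqr_ge0.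
  by have := sqr_ge0 (`|I w| - 1); have := normr_ge0 (I w); lra.
Qed.

Lemma increment_sqr_mean : p <= q -> \int[P]_w (I w ^+ 2) = q - p.
Proof.
rewrite le_eqVlt => /predU1P[pq|pq].
  rewrite pq subrr (@eq_Rintegral _ _ _ P _ (cst 0)) ?Rintegral_cst ?mul0r//.
  by move=> w _; rewrite /I pq subrr expr0n.
by rewrite /Rintegral increment_second_moment.
Qed.

Lemma increment_mean : p <= q -> \int[P]_w I w = 0.
Proof.
move=> /[dup] pq; rewrite le_eqVlt => /predU1P[pq'|pq'].
  rewrite (_ : I = cst 0) ?Rintegral_cst ?mul0r//.
  by apply/funext => w; rewrite /I pq' subrr.
have := increment_shifted_moment 1 pq' => h1.
have {h1} : \int[P]_w ((I w + 1) ^+ 2) = q - p + 1 by rewrite /Rintegral h1 expr1n.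
have -> : (fun w => (I w + 1) ^+ 2) = (fun w => I w ^+ 2 + (2 * I w + 1)).
  by apply/funext => w; ring.
have iI := rint_increment pq; have i2I := rintZ 2 iI.
rewrite RintegralD//; [|exact: rint_increment_sqr|exact: rintD (rint_cst _ _)].
rewrite RintegralD//; last exact: rint_cst.
rewrite RintegralZl// Rintegral_cst// increment_sqr_mean//.
have P1 : fine (P setT) = 1 by rewrite probability_setT.
by rewrite P1; lra.
Qed.

Lemma increment_indep (A B : set _) : p < q -> F p A -> measurable B ->
  P (A `&` I @^-1` B) = (P A * P (I @^-1` B))%E.
Proof. by move=> pq FA mB; exact: (bm_independent hW p0 pq FA mB). Qed.

Lemma increment_condexp A : p <= q -> F p A -> \int[P]_(w in A) I w = 0.
Proof.
move=> /[dup] pq; rewrite le_eqVlt => /predU1P[pq' _|pq' FA].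
  rewrite (@eq_Rintegral _ _ _ P _ (cst 0)).
    by rewrite /Rintegral integral0.
  by move=> w _; rewrite /I pq' subrr.
have mA : measurable A by exact: (filtration_sub hF p0 FA).
have := @Rintegral_indep _ _ _ P A I id mA (measurable_increment pq) _
  (fun B mB => increment_indep pq' FA mB) (rint_increment pq).
by rewrite increment_mean// mulr0; apply; exact: measurable_id.
Qed.

Lemma increment_sqr_condexp A : p <= q -> F p A ->
  \int[P]_(w in A) (I w ^+ 2) = fine (P A) * (q - p).
Proof.
move=> /[dup] pq; rewrite le_eqVlt => /predU1P[pq' _|pq' FA].
  rewrite (@eq_Rintegral _ _ _ P _ (cst 0)).
    by rewrite pq' subrr mulr0 /Rintegral integral0.
  by move=> w _; rewrite /I pq' subrr expr0n.
have mA : measurable A by exact: (filtration_sub hF p0 FA).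
have := @Rintegral_indep _ _ _ P A I (fun x => x ^+ 2) mA (measurable_increment pq) _
  (fun B mB => increment_indep pq' FA mB) (rint_increment_sqr pq).
by rewrite increment_sqr_mean//; apply; exact: measurable_funX.
Qed.

(** This disposes of the cross term when the square of a window is expanded between two times. *)
Lemma increment_orthogonal X : p <= q -> smeas (F p) X ->
  rint P (fun w => X w ^+ 2) -> \int[P]_w (X w * I w) = 0.
Proof.
move=> pq mX iX.
apply: (Rintegral_mul_integrable_eq0 (filtration_sigma hF p0)
  (filtration_sub hF p0)) => //.
- exact: rint_increment.
- apply: (@rint_le _ _ _ _ _ (fun w => X w ^+ 2 + I w ^+ 2)).
  + apply: measurable_funM; last exact: measurable_increment.
    exact: smeas_measurable (filtration_sub hF p0) mX.
  + by apply: rintD => //; exact: rint_increment_sqr.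
  + move=> w; rewrite [leRHS]ger0_norm ?addr_ge0 ?sqr_ge0// ler_norml.
    have : 0 <= (X w - I w) ^+ 2 by rewrite sqr_ge0.
    have : 0 <= (X w + I w) ^+ 2 by rewrite sqr_ge0.
    have := sqr_ge0 (X w); have := sqr_ge0 (I w).
    by move=> *; apply/andP; split; nra.
- by move=> A FA; exact: increment_condexp.
Qed.

End BrownianIncrements.

(** * Integrals of indicators and their characteristics *)

Section BrownianIntegrals.
Context {R : realType} {d : measure_display} {T : measurableType d}.
Variables (P : probability T R) (F : R -> set (set T)) (W : R -> T -> R).
Hypotheses (hF : usual_filtration P F) (hW : brownian_motion P F W).

(* [window a b] is the integral of the indicator of [[a, b]], and [window_length a b]
   its square characteristic. *)
Definition window (a b : R) (t : R) (w : T) : R :=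
  W (Num.min t b) w - W (Num.min t a) w.

Definition window_length (a b : R) (t : R) : R := Num.min t b - Num.min t a.

(** The window moves as [W] does over the intersection of [[s, t]] and [[a, b]], or not at all. That
    [s <= p] makes events of [F s] events of [F p], hence independent of a nondegenerate
    increment. *)
Lemma window_incr a b s t : 0 <= a -> a <= b -> 0 <= s -> s <= t ->
  exists p q, [/\ s <= p, p <= q,
    window_length a b t - window_length a b s = q - p &
    forall w, window a b t w - window a b s w = W q w - W p w].
Proof.
move=> a0 ab s0 st; rewrite /window /window_length.
have [sa|/ltW as_] := leP s a.
  have -> : Num.min s b = s by rewrite min_l// (le_trans sa).
  exists (Num.min t a), (Num.min t b); split => // [|||w].
  - by rewrite le_min st.
  - by rewrite le_min ge_min lexx/= ge_min ab orbT.
  - by ring.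
  - by ring.
have -> : Num.min t a = a by rewrite min_r// (le_trans as_).
have [sb|/ltW bs] := leP s b.
  exists s, (Num.min t b); split => // [||w]; [by rewrite le_min st|ring..].
have -> : Num.min t b = b by rewrite min_r// (le_trans bs).
by exists s, s; split => // [|w]; ring.
Qed.

Variables a b : R.
Hypotheses (a0 : 0 <= a) (ab : a <= b).
Local Notation X := (window a b).
Local Notation Q := (window_length a b).

Lemma window_length_mono s t : 0 <= s -> s <= t -> Q s <= Q t.
Proof.
move=> s0 st; have [p [q [_ pq e _]]] := window_incr a0 ab s0 st.
by rewrite -subr_ge0 e subr_ge0.
Qed.

Lemma window_length0 : Q 0 = 0.
Proof. by rewrite /window_length !min_l// ?subrr// (le_trans a0). Qed.

Lemma window0 w : X 0 w = 0.
Proof. by rewrite /window !min_l// ?subrr// (le_trans a0). Qed.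

Lemma window_adapted : adapted F X.
Proof.
move=> t t0; apply/smeasP; first exact: (filtration_sigma hF t0).
apply: measurable_funB; (apply/smeasP; first exact: (filtration_sigma hF t0)).
  by apply: (smeas_brownian hF hW); rewrite ?le_min ?t0 ?ge_min ?lexx ?(le_trans a0).
by apply: (smeas_brownian hF hW); rewrite ?le_min ?t0 ?ge_min ?lexx.
Qed.

Lemma window_continuous : continuous_paths X.
Proof.
have cW : continuous_paths W := bm_continuous hW.
have minc c w : 0 <= c -> {within [set t | 0 <= t], continuous (fun t => W (Num.min t c) w)}.
  move=> c0; apply: dist_within_continuous => x e x0 e0.
  have ge0 y : 0 <= y -> 0 <= Num.min y c by move=> y0; rewrite le_min y0.
  have [delta d0 hd] := within_continuous_dist (cW w) (ge0 x x0) e0.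
  exists delta => // y y0 xy; apply: hd; first exact: ge0.
  apply: le_lt_trans xy; rewrite ler_norml; have := ler_norm (x - y).
  have := ler_norm (- (x - y)); rewrite normrN /Num.min.
  by case: (ltP x c) => ?; case: (ltP y c) => ?; lra.
move=> w x; apply: cvgB; last exact: minc.
by apply: minc; exact: le_trans ab.
Qed.

Lemma window_length_continuous : {within [set t : R | 0 <= t], continuous Q}.
Proof.
(* The length is a difference of two 1-Lipschitz functions. *)
apply: dist_within_continuous => x e x0 e0; exists (e / 2); first by rewrite divr_gt0.
move=> y y0 xy; rewrite /window_length /Num.min.
have := ler_norm (x - y); have := ler_norm (- (x - y)); rewrite normrN ltr_norml.
by case: (ltP x a) => ?; case: (ltP y a) => ?; case: (ltP x b) => ?;
  case: (ltP y b) => ?; lra.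
Qed.

Lemma window_ord t : 0 <= t -> 0 <= Num.min t a /\ Num.min t a <= Num.min t b.
Proof.
move=> t0; rewrite le_min t0 a0; split => //.
by rewrite le_min ge_min lexx/= ge_min ab orbT.
Qed.

Lemma rint_window_sqr t : 0 <= t -> rint P (fun w => X t w ^+ 2).
Proof.
by move=> /window_ord[h1 h2]; exact: (rint_increment_sqr hF hW h1 h2).
Qed.

Lemma rint_window t : 0 <= t -> rint P (X t).
Proof. by move=> /window_ord[h1 h2]; exact: (rint_increment hF hW h1 h2). Qed.

Lemma window_martingale : martingale P F X.
Proof.
apply: (Rintegral_martingale hF window_adapted rint_window) => s t s0 st A FA.
have [p [q [sp pq _ e]]] := window_incr a0 ab s0 st.
have p0 := le_trans s0 sp; have t0 := le_trans s0 st.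
have mA : measurable A := filtration_sub hF s0 FA.
apply/eqP; rewrite -subr_eq0 -RintegralB//; last 2 first.
- exact: (integrableS _ _ _ (rint_window t0)).
- exact: (integrableS _ _ _ (rint_window s0)).
rewrite (funext e); apply/eqP; apply: (increment_condexp hF hW p0 pq).
exact: (filtration_mono hF s0 sp).
Qed.

(** With [I] the increment from [s] to [t], [X t ^+ 2 = X s ^+ 2 + I ^+ 2 + 2 * X s * I]. Over an
    event of the past, [I ^+ 2] has the mean of the length gained and the cross term vanishes. *)
Lemma window_sqr_martingale : martingale P F (fun t w => X t w ^+ 2 - Q t).
Proof.
apply: (Rintegral_martingale hF).
- move=> t t0; apply/smeasP; first exact: (filtration_sigma hF t0).
  apply: measurable_funB => //; apply: measurable_funX.
  by apply/smeasP; [exact: (filtration_sigma hF t0)|exact: window_adapted].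
- by move=> t t0; apply: rintB; [exact: rint_window_sqr|exact: rint_cst].
move=> s t s0 st A FA.
have [p [q [sp pq eQ eX]]] := window_incr a0 ab s0 st.
have p0 := le_trans s0 sp; have t0 := le_trans s0 st.
have mA : measurable A := filtration_sub hF s0 FA.
have FpA : F p A by exact: (filtration_mono hF s0 sp).
set I := fun w => W q w - W p w.
have iI : rint P (fun w => I w ^+ 2) := rint_increment_sqr hF hW p0 pq.
have iXs := rint_window_sqr s0.
have mXs : smeas (F p) (X s).
  by move=> B mB; apply: (filtration_mono hF s0 sp); exact: window_adapted.
(* The indicator of [A] is absorbed into the multiplier, so that orthogonality on the whole space
   gives it on [A]. *)
have mXA : smeas (F p) (fun w => \1_A w * X s w).
  apply/smeasP; first exact: (filtration_sigma hF p0).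
  apply: measurable_funM.
    apply: measurable_indic.
    by rewrite (measurable_g_measurableTypeE (filtration_sigma hF p0)).
  by apply/smeasP => //; exact: (filtration_sigma hF p0).
have subp := filtration_sub hF p0.
have iXI : rint P (fun w => X s w * I w).
  apply: (@rint_le _ _ _ _ _ (fun w => X s w ^+ 2 + I w ^+ 2)).
  - apply: measurable_funM; first exact: smeas_measurable mXs.
    exact: (measurable_increment hF hW p0 pq).
  - exact: rintD.
  - move=> w; rewrite [leRHS]ger0_norm ?addr_ge0 ?sqr_ge0// ler_norml.
    have := sqr_ge0 (X s w - I w); have := sqr_ge0 (X s w + I w).
    have := sqr_ge0 (X s w); have := sqr_ge0 (I w).
    by move=> *; apply/andP; split; nra.
have XI0 : \int[P]_(w in A) (X s w * I w) = 0.
  rewrite -Rintegral_indicM// (_ : (fun w => _) = (fun w => \1_A w * X s w * I w)).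
    apply: (increment_orthogonal hF hW p0 pq mXA).
    rewrite (_ : (fun w => _) = (fun w => \1_A w * X s w ^+ 2)); first exact: rint_indicM.
    by apply/funext => w; rewrite exprMn indicE; case: (_ \in _); rewrite ?expr1n ?expr0n.
  by apply/funext => w; rewrite mulrA.
have E w : X t w ^+ 2 - Q t =
    (X s w ^+ 2 - Q s) + ((I w ^+ 2 - (q - p)) + 2 * (X s w * I w)).
  have -> : X t w = X s w + I w by have := eX w; rewrite /I; lra.
  have -> : Q t = Q s + (q - p) by lra.
  by ring.
have onA Y : rint P Y -> P.-integrable A (EFin \o Y).
  by move=> iY; apply: (integrableS _ _ _ iY).
have i1 : rint P (fun w => X s w ^+ 2 - Q s) by apply: rintB => //; exact: rint_cst.
have i2 : rint P (fun w => I w ^+ 2 - (q - p)) by apply: rintB => //; exact: rint_cst.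
have i3 : rint P (fun w => 2 * (X s w * I w)) by exact: rintZ.
rewrite (funext E) RintegralD//; [|exact: (onA _ i1)|exact: (onA _ (rintD i2 i3))].
rewrite [X in _ + X]RintegralD//; [|exact: (onA _ i2)|exact: (onA _ i3)].
rewrite [X in _ + (_ + X)]RintegralZl//; last exact: (onA _ iXI).
rewrite XI0 mulr0 addr0 [X in _ + X]RintegralB//;
  [|exact: (onA _ iI)|exact: (onA _ (rint_cst P _))].
rewrite (increment_sqr_condexp hF hW p0 pq FpA) Rintegral_cst//.
by rewrite mulrC subrr addr0.
Qed.

(** Localized by the stopping times that are constantly infinite. *)
Lemma martingale_local M : martingale P F M -> local_martingale P F M.
Proof.
move=> mM; split; first exact: martingale_adapted mM.
exists (fun _ _ => +oo%E); split.
- move=> _; split => // t t0; rewrite (_ : [set w | _] = set0).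
    by case: (filtration_sigma hF t0).
  by apply/seteqP; split => w //=; rewrite leye_eq.
- by apply: aeW => w n.
- by apply: aeW => w; exact: cvg_cst.
- move=> _; rewrite (_ : stopped M _ = M)//.
  by apply/funext => t; apply/funext => w; rewrite /stopped min_l ?leey.
Qed.

Lemma cfv_deterministic (g : R -> R) :
  {within [set t | 0 <= t], continuous g} -> g 0 = 0 ->
  (forall s t, 0 <= s -> s <= t -> g s <= g t) ->
  continuous_finite_variation0 F (fun t (_ : T) => g t).
Proof.
move=> cg g0 ndg; split => //.
- move=> t t0; apply/smeasP; first exact: (filtration_sigma hF t0).
  exact: measurable_cst.
- move=> w t t0; apply: nondecreasing_bounded_variation => x y.
  by rewrite !in_itv/= => /andP[x0 _] _; exact: ndg.
Qed.

Lemma martingale_own_part M : martingale P F M -> continuous_paths M ->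
  (forall w, M 0 w = 0) -> martingale_part P F M M.
Proof.
move=> mM cM M0; split; first by split => //; exact: martingale_local.
exists (fun _ _ => 0); last by move=> t w _; rewrite addr0.
by apply: (@cfv_deterministic (cst 0)) => // x; exact: cvg_cst.
Qed.

Lemma window_square_characteristic :
  square_characteristic P F X (fun t _ => Q t).
Proof.
exists X.
  exact: (martingale_own_part window_martingale window_continuous window0).
split.
- move=> t t0; apply/smeasP; first exact: (filtration_sigma hF t0).
  exact: measurable_cst.
- by move=> w; exact: window_length_continuous.
- by move=> w s t s0 st; exact: window_length_mono.
- by move=> w; exact: window_length0.
- exact/martingale_local/window_sqr_martingale.
Qed.

(** A constant sequence of step functions is enough: the half-open and the closed interval differ
    only at [a]. *)
Lemma window_indicator_integral : indicator_integrals P F W X.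
Proof.
exists a, b; split => //; split.
- exact: window_adapted.
- exact: window_continuous.
- exact: window0.
exists (fun _ => [:: (1, a, b)]); split.
  by move=> _ x; rewrite inE => /eqP->.
move=> t t0; split.
  rewrite (_ : (fun _ => _) = cst 0%E); first exact: cvg_cst.
  apply/funext => n /=; apply/eqP; rewrite eq_le; apply/andP; split; last first.
    by apply: integral_ge0 => u _; rewrite lee_fin sqr_ge0.
  have ms : measurable_fun setT (fun u : R => \1_(`]a, b]) u - \1_(`[a, b]) u : R).
    by apply: measurable_funB; exact: measurable_indic.
  (* The squared difference of the indicators is bounded by the indicator of [[set a]], whose
     integral is 0. *)
  rewrite -(@integral_set1 R (fun=> 1%E) a) integral_mkcond.
  rewrite [leRHS]integral_mkcond.
  apply: ge0_le_integral => //.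
  - by move=> u _; apply: erestrict_ge0 => v _; rewrite lee_fin sqr_ge0.
  - apply/(measurable_restrictT _ _).1; first exact: measurable_itv.
    apply: measurable_funTS; apply/measurable_EFinP/measurable_funX.
    rewrite (_ : (fun u => _) = (fun u => \1_(`]a, b]) u - \1_(`[a, b]) u)).
      exact: ms.
    by apply/funext => u; rewrite /step_fun big_seq1 mul1r.
  - apply: (proj1 (measurable_restrictT (fun=> 1%E) _)) => //; exact: measurable_cst.
  - move=> u _; rewrite /patch /step_fun big_seq1 mul1r !indicE !mem_setE !in_itv/=.
    have [->|ua] := eqVneq u a.
      rewrite [X in (_ <= X)%E]ifT; last exact/mem_set.
      case: ifP => _ //; rewrite lee_fin ltxx/= sub0r sqrrN.
      by case: (_ && _); rewrite ?expr1n ?expr0n//= ?ler01.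
    rewrite [X in (_ <= X)%E]ifF; last first.
      by apply/negbTE/negP => /set_mem/= ua'; rewrite ua' eqxx in ua.
    have -> : (a <= u) = (a < u) by rewrite le_eqVlt eq_sym (negbTE ua).
    by case: ifP => // _; rewrite subrr expr0n.
rewrite (_ : (fun _ => _) = cst 0%E); first exact: cvg_cst.
apply/funext => n /=; under eq_integral do
  rewrite /step_integral big_seq1 mul1r subrr expr0n.
exact: integral0.
Qed.

End BrownianIntegrals.

(** * The functional equation along Brownian windows *)

Section BrownianSolution.
Context {R : realType} {d : measure_display} {T : measurableType d}.
Variables (P : probability T R) (F : R -> set (set T)) (W : R -> T -> R).
Hypotheses (hF : usual_filtration P F) (hW : brownian_motion P F W).
Variable f : R -> R -> R.
Hypothesis solf : solution P F (indicator_integrals P F W) f.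
Variables u v : R.
Hypotheses (u0 : 0 <= u) (v0 : 0 <= v).

Lemma solution_disjoint_windows : {ae P, forall w,
  f u (W u w - W 0 w) * f v (W (u + v) w - W u w) =
  f (u + v) (W (u + v) w - W 0 w)}.
Proof.
have uv : u <= u + v by rewrite lerDl.
have uv0 : 0 <= u + v by rewrite addr_ge0.
pose X := window W 0 u; pose Y := window W u (u + v); pose S := window W 0 (u + v).
have XYS : (fun t w => X t w + Y t w) = S.
  by apply/funext => t; apply/funext => w; rewrite /X /Y /S /window; ring.
have mX := window_martingale hF hW (lexx 0) u0.
have mY := window_martingale hF hW u0 uv.
have cX := window_continuous hW (lexx 0) u0.
have cY := window_continuous hW u0 uv.
have sX := window_square_characteristic hF hW (lexx 0) u0.
have sY := window_square_characteristic hF hW u0 uv.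
have sS := window_square_characteristic hF hW (lexx 0) uv0.
have mXY : martingale P F (fun t w => X t w * Y t w - 0).
  (* [X * Y] is half of [S ^+ 2 - X ^+ 2 - Y ^+ 2], and the lengths cancel because the two intervals
     together fill [[0, u + v]]. Hence [<X, Y> = 0]. *)
  have := martingale_lin hF 2^-1 (- 2^-1)
    (window_sqr_martingale hF hW (lexx 0) uv0)
    (martingale_lin hF 1 1 (window_sqr_martingale hF hW (lexx 0) u0)
                           (window_sqr_martingale hF hW u0 uv)).
  congr martingale; apply/funext => t; apply/funext => w.
  by rewrite /X /Y /window /window_length; field.
have cXY : mutual_characteristic P F X Y (fun _ _ => 0).
  exists X, Y; split.
  - exact: (martingale_own_part hF mX cX (window0 W (lexx 0) u0)).
  - exact: (martingale_own_part hF mY cY (window0 W u0 uv)).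
  - by apply: (cfv_deterministic hF (g := cst 0)) => // x; exact: cvg_cst.
  - exact: (martingale_local hF).
move: sS; rewrite -/S -XYS => sS.
have := solf (window_indicator_integral hF hW (lexx 0) u0)
  (window_indicator_integral hF hW u0 uv) sX sY cXY sS uv0.
apply: filterS => w; rewrite addr0 /X /Y /window /window_length.
rewrite !minxx (min_r uv) (min_r uv0) !subr0 [u + v - u]addrAC subrr add0r.
by have <- : W u w - W 0 w + (W (u + v) w - W u w) = W (u + v) w - W 0 w by ring.
Qed.

(** With [Y = X] one has [<X, Y> = <X>] and [<X + Y> = 4 <X>]. The shift by [u] in the second
    argument is what later ties the dependence on [u] to the slope in [x]. *)
Lemma solution_same_window : {ae P, forall w,
  f u (W u w - W 0 w) ^+ 2 = f (4 * u) (2 * (W u w - W 0 w) + u)}.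
Proof.
pose X := window W 0 u.
have mX := window_martingale hF hW (lexx 0) u0.
have cX := window_continuous hW (lexx 0) u0.
have X0 w : X 0 w = 0 := window0 W (lexx 0) u0 w.
have sX := window_square_characteristic hF hW (lexx 0) u0.
have pX : martingale_part P F X X := martingale_own_part hF mX cX X0.
pose Q := @window_length R 0 u.
have mX2 := window_sqr_martingale hF hW (lexx 0) u0.
have QC := @window_length_continuous R 0 u.
have Qnd s t := window_length_mono W (lexx 0) u0 (s := s) (t := t).
have Q0 : Q 0 = 0 := window_length0 (lexx 0) u0.
have cXX : mutual_characteristic P F X X (fun t _ => Q t).
  exists X, X; split => //; first exact: (cfv_deterministic hF).
  by apply: (martingale_local hF); exact: mX2.
have sS : square_characteristic P F (fun t w => X t w + X t w) (fun t _ => 4 * Q t).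
  exists (fun t w => X t w + X t w).
    apply: (martingale_own_part hF).
    - have := martingale_lin hF 1 1 mX mX.
      by congr martingale; apply/funext => t; apply/funext => w; rewrite !mul1r.
    - by move=> w x; apply: cvgD; exact: cX.
    - by move=> w; rewrite X0 addr0.
  split.
  - move=> t t0; apply/smeasP; first exact: (filtration_sigma hF t0).
    exact: measurable_cst.
  - by move=> w x; apply: cvgM; [exact: cvg_cst|exact: QC].
  - by move=> w s t s0 st; rewrite ler_wpM2l// Qnd.
  - by move=> w; rewrite Q0 mulr0.
  - apply: (martingale_local hF).
    have := martingale_lin hF 4 0 mX2 mX2.
    by congr martingale; apply/funext => t; apply/funext => w; rewrite /X /Q; ring.
have iX := window_indicator_integral hF hW (lexx 0) u0.
have := solf iX iX sX sX cXX sS u0.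
apply: filterS => w; rewrite /X /Q /window /window_length.
rewrite !minxx (min_r u0) subr0 -expr2 => ->.
by congr (f _ _); ring.
Qed.

End BrownianSolution.

(** * From Gaussian laws to Lebesgue measure *)

Section NormalNull.
Context {R : realType}.
Variable s : R.
Hypothesis s0 : s != 0.
Local Notation mu := (@lebesgue_measure R).

Lemma normal_pdf_gt0 x : 0 < normal_pdf 0 s x.
Proof. by rewrite normal_pdfE// mulr_gt0 ?normal_peak_gt0// expR_gt0. Qed.

Lemma normal_null_lebesgue_null (A : set R) : measurable A ->
  normal_prob 0 s A = 0%E -> mu A = 0%E.
Proof.
move=> mA; rewrite /normal_prob => A0.
have mp : measurable_fun A (fun x => (normal_pdf 0 s x)%:E).
  by apply/measurable_funTS/measurable_EFinP; exact: measurable_normal_pdf.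
have : (\int[mu]_(x in A) `|(normal_pdf 0 s x)%:E| = 0)%E.
  rewrite -[RHS]A0; apply: eq_integral => x _.
  by rewrite gee0_abs// lee_fin normal_pdf_ge0.
move/(ae_eq_integral_abs mu mA mp) => [B [mB B0 AB]].
apply/eqP; rewrite -measure_le0 -B0 le_measure ?inE// => x Ax.
apply: AB => /= /(_ Ax) [] /eqP.
by rewrite gt_eqF// normal_pdf_gt0.
Qed.

Lemma normal_ae_lebesgue_ae (Q : set R) :
  {ae normal_prob 0 s, forall x, Q x} -> {ae mu, forall x, Q x}.
Proof.
move=> [B [mB B0 QB]]; exists B; split => //.
exact: normal_null_lebesgue_null.
Qed.

End NormalNull.

Section ProductLaw.
Context {R : realType} {d : measure_display} {T : measurableType d}.
Variables (P : probability T R) (X Y : T -> R) (s1 s2 : R).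
Hypotheses (s10 : s1 != 0) (s20 : s2 != 0).
Hypotheses (mX : measurable_fun setT X) (mY : measurable_fun setT Y).
Hypothesis indep : forall A B : set R, measurable A -> measurable B ->
  P (X @^-1` A `&` Y @^-1` B) = (normal_prob 0 s1 A * normal_prob 0 s2 B)%E.
Local Notation mu := (@lebesgue_measure R).
Local Notation RR := (measurableTypeR R).

(** A law that factors on rectangles is the product measure, so by Fubini an almost sure property of
    [(X, Y)] fails only on null sections; Gaussian null sets are then Lebesgue null. *)
Lemma product_law_ae (C : set (RR * RR)) : measurable C ->
  {ae P, forall w, C (X w, Y w)} ->
  {ae mu, forall x, {ae mu, forall y, C (x, y)}}.
Proof.
move=> mC aeC.
have mX' : measurable_fun setT (X : T -> RR) by exact: mX.
have mY' : measurable_fun setT (Y : T -> RR) by exact: mY.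
have mZ : measurable_fun setT (fun w => (X w, Y w) : RR * RR).
  exact: measurable_fun_pair.
pose Z : {mfun T >-> (RR * RR)%type} :=
  HB.pack (fun w => (X w, Y w) : RR * RR) (isMeasurableFun.Build _ _ _ _ _ mZ).
have mCC : measurable (~` C) by exact: measurableC.
have law0 : distribution P Z (~` C) = 0%E.
  have [N [mN N0 CN]] := aeC.
  have mZC : measurable ((fun w => (X w, Y w) : RR * RR) @^-1` (~` C)).
    by rewrite -[X in measurable X]setTI; exact: (mZ measurableT _ mCC).
  apply/eqP; rewrite -measure_le0 -N0.
  have := @le_measure _ _ _ P _ N (mem_set mZC) (mem_set mN).
  by apply => w; exact: CN.
have := etrans (@product_measure_unique _ _ RR RR R (normal_prob 0 s1)
  (normal_prob 0 s2) (distribution P Z) indep (~` C) mCC) law0.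
rewrite /product_measure1 => int0.
have mxs : measurable_fun setT (normal_prob 0 s2 \o xsection (~` C)).
  exact: measurable_fun_xsection.
have int0' : (\int[normal_prob 0 s1]_x
    `|(normal_prob 0 s2 \o xsection (~` C)) x| = 0)%E.
  by rewrite -[RHS]int0; apply: eq_integral => x _; rewrite gee0_abs.
have := (ae_eq_integral_abs (normal_prob 0 s1) measurableT mxs).1 int0'.
move=> h; apply: (normal_ae_lebesgue_ae s10); apply: filterS h => x /(_ I) /= hx.
exists (xsection (~` C) x); split.
- exact: measurable_xsection.
- by apply: (normal_null_lebesgue_null s20) => //; exact: measurable_xsection.
- by move=> y Cy; rewrite /xsection/=; exact/mem_set.
Qed.

End ProductLaw.

Section LebesgueEquations.
Context {R : realType} {d : measure_display} {T : measurableType d}.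
Variables (P : probability T R) (F : R -> set (set T)) (W : R -> T -> R).
Hypotheses (hF : usual_filtration P F) (hW : brownian_motion P F W).
Variable f : R -> R -> R.
Hypothesis solf : solution P F (indicator_integrals P F W) f.
Hypothesis mf : forall u, 0 < u -> measurable_fun setT (f u).
Local Notation mu := (@lebesgue_measure R).
Local Notation RR := (measurableTypeR R).

Lemma solution_ae_multiplicative u v : 0 < u -> 0 < v ->
  {ae mu, forall x, {ae mu, forall y, f u x * f v y = f (u + v) (x + y)}}.
Proof.
move=> u0 v0; have uv : u < u + v by rewrite ltrDl.
pose X w := W u w - W 0 w; pose Y w := W (u + v) w - W u w.
have mX : measurable_fun setT X by exact: (measurable_increment hF hW (lexx 0) (ltW u0)).
have mY : measurable_fun setT Y by exact: (measurable_increment hF hW (ltW u0) (ltW uv)).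
have s1 : Num.sqrt (u - 0) != 0 by rewrite subr0 gt_eqF// sqrtr_gt0.
have s2 : Num.sqrt (u + v - u) != 0 by rewrite gt_eqF// sqrtr_gt0 subr_gt0.
have indep (A B : set R) : measurable A -> measurable B ->
    P (X @^-1` A `&` Y @^-1` B) = (normal_prob 0 (Num.sqrt (u - 0)%R) A *
      normal_prob 0 (Num.sqrt (u + v - u)%R) B)%E.
  move=> mA mB; have h1 := bm_gaussian hW (lexx 0) u0 mA.
  have h2 := bm_gaussian hW (ltW u0) uv mB.
  rewrite -h1 -h2; apply: (bm_independent hW (ltW u0) uv) => //.
  have XF : smeas (F u) X.
    apply/smeasP; first exact: (filtration_sigma hF (ltW u0)).
    by apply: measurable_funB; (apply/smeasP; first exact: (filtration_sigma hF (ltW u0)));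
      apply: (smeas_brownian hF hW) => //; exact: ltW.
  exact: XF.
pose g (z : RR * RR) : R := f u z.1 * f v z.2 - f (u + v) (z.1 + z.2).
have mg : measurable_fun setT g.
  apply: measurable_funB.
    apply: measurable_funM; apply: measurableT_comp => //; exact: mf.
  apply: measurableT_comp; first by apply: mf; rewrite addr_gt0.
  exact: measurable_funD.
have mC : measurable (g @^-1` [set 0]).
  by rewrite -[X in measurable X]setTI; apply: mg.
have := product_law_ae s1 s2 mX mY indep mC.
have := solution_disjoint_windows hF hW solf (ltW u0) (ltW v0).
move=> h /(_ _)/wrap[].
  by apply: filterS h => w; rewrite /g /= => ->; rewrite (_ : X w + Y w = W (u + v) w - W 0 w)
    ?subrr//; rewrite /X /Y; ring.
apply: filterS => x; apply: filterS => y; rewrite /g/= => /eqP.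
by rewrite subr_eq0 => /eqP.
Qed.

Lemma solution_ae_square u : 0 < u ->
  {ae mu, forall x, f u x ^+ 2 = f (4 * u) (2 * x + u)}.
Proof.
move=> u0; pose X w := W u w - W 0 w.
have mX : measurable_fun setT X by exact: (measurable_increment hF hW (lexx 0) (ltW u0)).
have s1 : Num.sqrt (u - 0) != 0 by rewrite subr0 gt_eqF// sqrtr_gt0.
apply: (normal_ae_lebesgue_ae s1).
pose g x : R := f u x ^+ 2 - f (4 * u) (2 * x + u).
have mg : measurable_fun setT g.
  apply: measurable_funB; first by apply: measurable_funX; exact: mf.
  apply: measurableT_comp; first by apply: mf; rewrite mulr_gt0.
  by apply: measurable_funD => //; apply: measurable_funM.
have mC : measurable (g @^-1` [set~ 0]).
  by rewrite -[X in measurable X]setTI; apply: mg => //; exact: measurableC.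
exists (g @^-1` [set~ 0]); split => //; last first.
  by move=> x /= h /eqP; rewrite subr_eq0 => /eqP.
have [N [mN N0 CN]] := solution_same_window hF hW solf (ltW u0).
have hg := bm_gaussian hW (lexx 0) u0 mC.
rewrite -hg; apply/eqP; rewrite -measure_le0 -N0.
have mXC : measurable (X @^-1` (g @^-1` [set~ 0])).
  by rewrite -[X in measurable X]setTI; apply: mX.
have := @le_measure _ _ _ P _ N (mem_set mXC) (mem_set mN).
by apply => w /= gw; apply: CN => /= h; apply: gw; rewrite /g /X h subrr.
Qed.

End LebesgueEquations.

(** * The Cauchy equation almost everywhere *)

Section LebesgueAffine.
Context {R : realType}.
Local Notation mu := (@lebesgue_measure R).
Local Notation RR := (measurableTypeR R).
Implicit Types (a c k : R) (A : set R).

Lemma lebesgue_aeS (Q Q' : R -> Prop) : (forall x, Q x -> Q' x) ->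
  {ae mu, forall x, Q x} -> {ae mu, forall x, Q' x}.
Proof.
by move=> QQ'; apply: (@filterS _ _ (ae_filter_ringOfSetsType mu) _ _ QQ').
Qed.

Lemma measurable_affine k c : measurable_fun [set: RR] (fun x : R => k * x + c : RR).
Proof.
have : measurable_fun [set: R] (fun x : R => k * x + c).
  by apply: measurable_funD => //; exact: measurable_funM.
by [].
Qed.

Lemma measurable_affine_preimage k c (A : set RR) : measurable A ->
  measurable ((fun x : R => k * x + c) @^-1` A : set RR).
Proof. by move=> mA; have := measurable_affine k c measurableT mA; rewrite setTI. Qed.

(** [k] times the pushforward agrees with [mu] on the intervals []a, b]], and Lebesgue measure is
    determined by these. *)
Lemma lebesgue_measure_affine k c A : 0 < k -> measurable A ->
  (k%:E * mu ((fun x => k * x + c)%R @^-1` A) = mu A)%E.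
Proof.
move=> k0 mA; pose phi : {mfun RR >-> RR} := HB.pack (fun x : R => k * x + c : RR)
  (isMeasurableFun.Build _ _ _ _ _ (measurable_affine k c)).
have mphi := measurable_affine k c.
pose kn : {nonneg R} := NngNum (ltW k0).
have := @lebesgue_measure_unique R (mscale kn (pushforward mu phi)).
move=> /(_ mphi) h; rewrite [RHS]h// => _ [[a b] _ <-].
have phiE : phi @^-1` `]a, b]%classic = `](a - c) / k, (b - c) / k]%classic.
  apply/seteqP; split=> x /=; rewrite !in_itv/=.
    by rewrite ltr_pdivrMr// ler_pdivlMr// mulrC ltrBlDr lerBrDr.
  by rewrite ltr_pdivrMr// ler_pdivlMr// mulrC ltrBlDr lerBrDr.
transitivity (k%:E * mu (phi @^-1` `]a, b]%classic))%E; last by [].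
rewrite phiE.
rewrite !lebesgue_measure_itv/= !lte_fin ltr_pM2r ?invr_gt0// ltrD2r.
case: ifP => _; last by rewrite mule0.
by rewrite -!EFinD -EFinM; congr (_%:E); field; rewrite gt_eqF.
Qed.

Lemma lebesgue_affine_ae k c (Q : set R) : 0 < k ->
  {ae mu, forall x, Q x} -> {ae mu, forall x, Q (k * x + c)}.
Proof.
move=> k0 [N [mN N0 QN]]; exists ((fun x => k * x + c) @^-1` N); split.
- exact: measurable_affine_preimage.
- have := lebesgue_measure_affine c k0 mN; rewrite N0 => /eqP.
  by rewrite mule_eq0 eqe gt_eqF//= => /eqP.
- by move=> x /= Qx; apply: QN.
Qed.

Lemma lebesgue_measure_reflect c A : measurable A ->
  mu ((fun x => c - x)%R @^-1` A) = mu A.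
Proof.
move=> mA.
pose A' := (fun x => 1 * x + c) @^-1` A.
have mA' : measurable (A' : set RR) by exact: measurable_affine_preimage.
have := lebesgue_measure_affine c ltr01 mA; rewrite mul1e => <-.
rewrite -(lebesgue_measureN mA'); congr (mu _); apply/seteqP.
by split=> x; rewrite /A'/= mul1r addrC.
Qed.

Lemma integral_translate (h : R -> R) c (D : set R) : measurable D ->
  measurable_fun setT h ->
  mu.-integrable ((fun x => c + x) @^-1` D) (EFin \o (fun x => h (c + x))) ->
  (\int[mu]_(x in (fun x => c + x)%R @^-1` D) (h (c + x))%:E =
   \int[mu]_(z in D) (h z)%:E)%E.
Proof.
move=> mD mh ih.
have mphi : measurable_fun [set: RR] (fun x : R => c + x : RR).
  have -> : (fun x : R => c + x) = (fun x => 1 * x + c).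
    by apply/funext => x; rewrite mul1r addrC.
  exact: measurable_affine.
pose phi : {mfun RR >-> RR} := HB.pack (fun x : R => c + x : RR)
  (isMeasurableFun.Build _ _ _ _ _ mphi).
have mh' : measurable_fun [set: RR] (EFin \o h) by apply/measurable_EFinP.
have := @integral_pushforward _ _ RR RR R phi mphi mu D (EFin \o h) mh' ih mD.
move=> /= <-; apply: eq_measure_integral => A mA _.
rewrite -[LHS]mul1e -[RHS](lebesgue_measure_affine c ltr01 mA).
congr (_ * mu _)%E; apply/seteqP.
by split=> x /=; rewrite mul1r addrC.
Qed.

(** By Tonelli both conditions say that the complement of [C] has planar measure 0. *)
Lemma ae_swap (C : set (RR * RR)) : measurable C ->
  {ae mu, forall x, {ae mu, forall y, C (x, y)}} ->
  {ae mu, forall y, {ae mu, forall x, C (x, y)}}.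
Proof.
move=> mC aeC; have mCC : measurable (~` C) by exact: measurableC.
have fub := @indic_fubini_tonelli _ _ RR RR R mu mu _ mCC.
have mxs x : measurable (xsection (~` C) x) by exact: measurable_xsection.
have mys y : measurable (ysection (~` C) y) by exact: measurable_ysection.
have x0 : (\int[mu]_x (mu \o xsection (~` C)) x = 0)%E.
  have mfx : measurable_fun setT (mu \o xsection (~` C)).
    exact: measurable_fun_xsection.
  have : (\int[mu]_x `|(mu \o xsection (~` C)) x| = 0)%E.
    apply/(ae_eq_integral_abs mu measurableT mfx); apply: filterS aeC => x.
    move=> [N [mN N0 CN]] _ /=; apply/eqP; rewrite -measure_le0 -N0.
    rewrite le_measure ?inE// => y /xsectionP xy.
    exact: CN.
  by move=> <-; apply: eq_integral => x _; rewrite gee0_abs.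
have y0 : (\int[mu]_y (mu \o ysection (~` C)) y = 0)%E.
  rewrite -x0; apply/esym; rewrite -indic_fubini_tonelli_FE// -indic_fubini_tonelli_GE//.
have mfy : measurable_fun setT (mu \o ysection (~` C)).
  exact: measurable_fun_ysection.
have : (\int[mu]_y `|(mu \o ysection (~` C)) y| = 0)%E.
  by rewrite -[RHS]y0; apply: eq_integral => y _; rewrite gee0_abs.
move/(ae_eq_integral_abs mu measurableT mfy); apply: filterS => y /(_ I)/= hy.
exists (ysection (~` C) y); split => // x Cx.
by rewrite /ysection/=; exact/mem_set.
Qed.

End LebesgueAffine.

(** * Essential boundedness *)

Section EssentialBound.
Context {R : realType}.
Local Notation mu := (@lebesgue_measure R).
Local Notation RR := (measurableTypeR R).

Definition superlevel (g : R -> R) (N K : R) : set RR :=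
  [set x : R | - N <= x <= N /\ K < `|g x|].

Lemma measurable_superlevel (g : R -> R) N K : measurable_fun setT g ->
  measurable (superlevel g N K).
Proof.
move=> mg; have -> : superlevel g N K = `[- N, N] `&` (fun x => `|g x|) @^-1` `]K, +oo[.
  by apply/seteqP; split=> x; rewrite /superlevel/= !in_itv/= andbT.
apply: measurableI; first exact: measurable_itv.
have mng : measurable_fun setT (fun x => `|g x|) by apply: measurableT_comp.
by rewrite -[X in measurable X]setTI; apply: mng => //; exact: measurable_itv.
Qed.

(** The superlevel sets at integer heights lie in a bounded interval and decrease to the empty set,
    so their measures tend to 0. *)
Lemma small_superlevel (g : R -> R) (N e : R) : measurable_fun setT g -> 0 < e ->
  exists K, (mu (superlevel g N K) < e%:E)%E.
Proof.
move=> mg e0; pose E (n : nat) := superlevel g N n%:R.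
have mE n : measurable (E n : set RR) by exact: measurable_superlevel.
have cvg0 : mu \o E @ \oo --> mu (\bigcap_n E n).
  apply: nonincreasing_cvg_mu => //.
  - apply: (@le_lt_trans _ _ (mu `[- N, N]%classic)).
      by rewrite le_measure ?inE// => x [xN _]; rewrite /= in_itv.
    by rewrite lebesgue_measure_itv/=; case: ifP => _; rewrite -?EFinD ltry.
  - exact: bigcapT_measurable.
  - apply/nonincreasing_seqP => n; rewrite subsetEset => x [xN h]; split => //.
    by rewrite (le_lt_trans _ h)// ler_nat.
have E0 : \bigcap_n E n = set0.
  apply/seteqP; split => // x /(_ (Num.bound `|g x|) I) [_].
  by apply/negP; rewrite -leNgt ltW// archi_boundP.
rewrite E0 measure0 in cvg0.
have cvgR : fine ((mu \o E) n) @[n --> \oo] --> (0 : R) by exact: (fine_cvg cvg0).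
move/cvgrPdist_lt : cvgR => /(_ e e0) near_e.
have fin : \forall n \near \oo, (mu \o E) n \is a fin_num by case/fine_cvgP: cvg0.
case: (filterI near_e fin) => n _ /(_ n (leqnn n))/= [h1 h2].
exists n%:R; rewrite -/(E n) -(fineK h2) lte_fin (le_lt_trans _ h1)//.
by rewrite sub0r normrN ler_norm.
Qed.

(* [g] is at most [K] off a set [E] of measure less than [1/2]; since [[-1, 1]] has
   measure 2, for almost every [z] some [x] in it avoids both [E] and [z - E] and
   satisfies [h z = g x + g (z - x)]. *)
Lemma convolution_ess_bounded (g h : R -> R) (N : R) : 0 <= N ->
  measurable_fun setT g -> measurable_fun setT h ->
  {ae mu, forall x, {ae mu, forall y, g x + g y = h (x + y)}} ->
  exists K, {ae mu, forall z, `|z| <= N -> `|h z| <= K}.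
Proof.
move=> N0 mg mh gh.
have half0 : 0 < 2^-1 :> R by [].
(* [N + 1] because [z - x] ranges over [[-(N + 1), N + 1]] when [|z| <= N] and [|x| <= 1]. *)
have [K EK] := small_superlevel (N + 1) mg half0.
set E := superlevel g (N + 1) K in EK.
have mE : measurable E by exact: measurable_superlevel.
exists (2 * K).
(* The equation in the variables [(x, z)] with [z = x + y], so that [ae_swap] can fix [z] and let
   [x] vary. *)
pose C : set (RR * RR) := [set z | g z.1 + g (z.2 - z.1) = h z.2].
have mC : measurable C.
  pose k (z : RR * RR) : R := g z.1 + g (z.2 - z.1) - h z.2.
  have mk : measurable_fun setT k.
    apply: measurable_funB; last exact: measurableT_comp.
    apply: measurable_funD; first exact: measurableT_comp.
    by apply: measurableT_comp => //; exact: measurable_funB.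
  rewrite (_ : C = k @^-1` [set 0]).
    by rewrite -[X in measurable X]setTI; apply: mk.
  apply/seteqP; split=> z; rewrite /C /k/=; first by move=> ->; rewrite subrr.
  by move=> /eqP; rewrite subr_eq0 => /eqP.
have aeC : {ae mu, forall x, {ae mu, forall z, C (x, z)}}.
  move: gh; apply: lebesgue_aeS => x /(lebesgue_affine_ae (- x) ltr01).
  by apply: lebesgue_aeS => z; rewrite /C/= mul1r => ->; rewrite subrKC.
have := ae_swap mC aeC; apply: lebesgue_aeS => z [B [mB B0 CB]] zN.
have mE' : measurable ((fun x => z - x) @^-1` E : set RR).
  rewrite -[X in measurable X]setTI.
  have : measurable_fun [set: R] (fun x => z - x) by apply: measurable_funB.
  by apply.
pose J : set RR := `[- 1, 1]%classic.
have notcover : ~ J `<=` E `|` (fun x => z - x) @^-1` E `|` B.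
  move=> cover.
  have m11 : measurable J by exact: measurable_itv.
  have mU : measurable (E `|` (fun x => z - x) @^-1` E : set RR) by exact: measurableU.
  have h1 : (mu J <= mu (E `|` (fun x => z - x)%R @^-1` E `|` B))%E.
    by rewrite le_measure ?inE//; exact: measurableU.
  have h2 : (mu (E `|` (fun x => z - x)%R @^-1` E `|` B) <= mu E + mu E)%E.
    have := measureU2 mu mU mB.
    rewrite [X in (_ <= _ + X)%E](_ : _ = 0%E) // adde0 => /le_trans; apply.
    have := measureU2 mu mE mE'.
    by rewrite [X in (_ <= _ + X)%E](_ : _ = mu E) //; exact: lebesgue_measure_reflect.
  have h3 : (mu E + mu E < (2^-1)%:E + (2^-1)%:E)%E by rewrite lteD.
  have := le_lt_trans (le_trans h1 h2) h3.
  rewrite lebesgue_measure_itv/= lte_fin ifT; last by rewrite (@lt_trans _ _ 0)// oppr_lt0.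
  by rewrite -!EFinD lte_fin; lra.
have [x [x1 nx]] : exists x, J x /\
    ~ (E `|` (fun x => z - x) @^-1` E `|` B) x.
  apply: contrapT => nex; apply: notcover => x x1; apply: contrapT => nx.
  by apply: nex; exists x.
move/not_orP: nx => [/not_orP[nE nE'] nB].
have : C (x, z) by apply: contrapT => nC; apply: nB; exact: CB.
rewrite /C/= => <-.
move: x1; rewrite /J/= in_itv/= => /andP[x1 x2].
move: zN; rewrite ler_norml => /andP[z1 z2].
have gx : `|g x| <= K.
  rewrite leNgt; apply/negP => gK; apply: nE; split => //.
  by apply/andP; split; lra.
have gzx : `|g (z - x)| <= K.
  rewrite leNgt; apply/negP => gK; apply: nE'; split => //.
  by apply/andP; split; lra.
by rewrite (le_trans (ler_normD _ _))// (le_trans (lerD gx gzx))//; lra.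
Qed.

Lemma ess_bounded_integrable (h : R -> R) (N K a b : R) : measurable_fun setT h ->
  {ae mu, forall z, `|z| <= N -> `|h z| <= K} -> - N <= a -> b <= N ->
  mu.-integrable `[a, b] (EFin \o h).
Proof.
move=> mh hK aN bN.
have mh' : measurable_fun (`[a, b]%classic : set RR) (EFin \o h).
  by apply/measurable_funTS/measurable_EFinP.
apply/integrableP; split => //.
apply: (@le_lt_trans _ _ (\int[mu]_(x in `[a, b]) `|K|%:E)%E); last first.
  rewrite integral_cst//= lebesgue_measure_itv/=.
  case: ifP => _; last by rewrite mule0; exact: ltry.
  by rewrite -EFinD -EFinM; exact: ltry.
apply: ae_ge0_le_integral => //=.
  by apply/measurable_EFinP/measurable_funTS/measurableT_comp.
move: hK; apply: lebesgue_aeS => x hx; rewrite in_itv/= => /andP[ax xb].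
rewrite lee_fin (le_trans (hx _))// ?ler_norm// ler_norml.
by rewrite (le_trans aN ax) (le_trans xb bN).
Qed.

End EssentialBound.

Section ContinuousAdditive.
Context {R : realType}.
Local Notation mu := (@lebesgue_measure R).

(** If the values differed at one point they would differ on an interval around it, which has
    positive measure. *)
Lemma continuous_ae_eq (f g : R -> R) : continuous f -> continuous g ->
  {ae mu, forall x, f x = g x} -> forall x, f x = g x.
Proof.
move=> cf cg [N [mN N0 fgN]] x; apply/eqP/negPn/negP; rewrite -subr_eq0 => fgx.
have cD : f y - g y @[y --> x] --> f x - g x by apply: cvgB; [exact: cf|exact: cg].
have e0 : 0 < `|f x - g x| by rewrite normr_gt0.
move/cvgrPdist_lt : cD => /(_ _ e0) /nbhs_ballP[r /= r0 hr].
pose J : set (measurableTypeR R) := `]x - r, x + r[%classic.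
have JN : J `<=` N.
  move=> y; rewrite /J/= in_itv/= => /andP[y1 y2]; apply: fgN => /= fgy.
  have xy : ball x r y by rewrite /ball/= ltr_norml; apply/andP; split; lra.
  by have := hr y xy; rewrite fgy subrr subr0 ltxx.
have mJ : measurable J by exact: measurable_itv.
have muJ : mu J = (2 * r)%:E.
  rewrite /J lebesgue_measure_itv/= lte_fin ifT; last lra.
  by rewrite -EFinD; congr (_%:E); ring.
have := @le_measure _ _ _ mu J N (mem_set mJ) (mem_set mN) JN.
rewrite [X in (_ <= X)%E](_ : _ = 0%E) // [X in (X <= _)%E](_ : _ = (2 * r)%:E) //.
by rewrite lee_fin; lra.
Qed.

(* [m x - m 1 * x] is additive and 1-periodic, hence bounded, hence zero. *)
Lemma additive_continuous_linear (m : R -> R) : continuous m ->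
  (forall x y, m (x + y) = m x + m y) -> forall x, m x = m 1 * x.
Proof.
move=> cm addm x; pose g y := m y - m 1 * y.
have addg y z : g (y + z) = g y + g z by rewrite /g addm; ring.
have g0 : g 0 = 0 by have := addg 0 0; rewrite addr0; lra.
have gN y : g (- y) = - g y by have := addg y (- y); rewrite subrr g0; lra.
have gM n y : g (n%:R * y) = n%:R * g y.
  elim: n => [|n ih]; first by rewrite !mul0r.
  by rewrite -natr1 !mulrDl addg ih !mul1r.
have g1 : g 1 = 0 by rewrite /g mulr1 subrr.
have gn n : g n%:R = 0 by have := gM n 1; rewrite mulr1 g1 mulr0.
have gz (z : int) : g z%:~R = 0.
  by case: z => n; rewrite ?NegzE ?mulrNz ?gN -pmulrn gn ?oppr0.
have cg : continuous (fun y => `|g y|).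
  move=> y; apply: cvg_norm; apply: cvgB; first exact: cm.
  by apply: cvgM; [exact: cvg_cst|exact: cvg_id].
have [c _ gc] := EVT_max (ler01 : (0 : R) <= 1) (continuous_subspaceT cg).
have gB y : `|g y| <= `|g c|.
  have -> : g y = g (y - (Num.floor y)%:~R) by rewrite addg gN gz subr0.
  apply: gc; rewrite in_itv/= subr_ge0 Num.Theory.floor_le/=.
  by have := floorD1_gt y; rewrite intrD; lra.
have : g x = 0.
  apply/eqP; rewrite -normr_le0; apply/ler_addgt0Pr => e e0; rewrite add0r.
  pose n := (Num.bound (`|g c| / e)).+1.
  have n0 : 0 < n%:R :> R by rewrite ltr0n.
  have := gB (n%:R * x); rewrite gM normrM (ger0_norm (ltW n0)) => h.
  have hn : `|g c| / e <= n%:R.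
    apply/ltW/(lt_le_trans (archi_boundP _)); first by rewrite divr_ge0// ltW.
    by rewrite ler_nat.
  by rewrite ler_pdivrMr// in hn; rewrite -(ler_pM2l n0) (le_trans h).
by rewrite /g; lra.
Qed.

End ContinuousAdditive.

(** * Continuous versions and the affine form *)

Section CauchyHalfPlane.
Context {R : realType}.
Local Notation mu := (@lebesgue_measure R).
Local Notation RR := (measurableTypeR R).
Variable L : R -> R -> R.
Hypothesis mL : forall u, 0 < u -> measurable_fun setT (L u).
Hypothesis addL : forall u v, 0 < u -> 0 < v ->
  {ae mu, forall x, {ae mu, forall y, L u x + L v y = L (u + v) (x + y)}}.
Hypothesis dblL : forall u, 0 < u ->
  {ae mu, forall x, 2 * L u x = L (4 * u) (2 * x + u)}.

(** Writing [u] as [u / 2 + u / 2] makes [L u] the right-hand side of an equation to which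
    [convolution_ess_bounded] applies. *)
Lemma cauchy_ess_bounded u N : 0 < u ->
  exists K, {ae mu, forall z, `|z| <= N -> `|L u z| <= K}.
Proof.
move=> u0; have u20 : 0 < u / 2 by rewrite divr_gt0.
have [|N0] := leP 0 N; last first.
  by exists 0; apply: aeW => z; have := normr_ge0 z; lra.
move=> N0; apply: (convolution_ess_bounded N0 (mL u20) (mL u0)).
by have := addL u20 u20; rewrite -splitr.
Qed.

Lemma cauchy_integrable u a b : 0 < u -> mu.-integrable `[a, b] (EFin \o L u).
Proof.
move=> u0; have [K hK] := cauchy_ess_bounded (`|a| + `|b|) u0.
apply: (ess_bounded_integrable (mL u0) hK).
  by rewrite lerNl (le_trans (ler_norm _))// normrN lerDl.
by rewrite (le_trans (ler_norm _))// lerDr.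
Qed.

Definition moving_integral (h : R -> R) (x : R) : R :=
  \int[mu]_(t in `[x, x + 1]) h t.

(** The result of integrating [L u x + L u y = L (u + u) (x + y)] over [y] in [[0, 1]] and solving
    for [L u x]. *)
Definition smooth_version (u x : R) : R :=
  moving_integral (L (u + u)) x - moving_integral (L u) 0.

Lemma smooth_version_ae u : 0 < u ->
  {ae mu, forall x, L u x = smooth_version u x}.
Proof.
move=> u0; have uu0 : 0 < u + u by rewrite addr_gt0.
have := addL u0 u0; apply: lebesgue_aeS => x hx.
rewrite /smooth_version /moving_integral add0r.
pose I01 : set RR := `[0, 1]%classic.
pose Ix : set RR := `[x, x + 1]%classic.
have mIx : measurable Ix by exact: measurable_itv.
have mI01 : measurable I01 by exact: measurable_itv.
have pre : (fun y => x + y) @^-1` Ix = I01.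
  by apply/seteqP; split=> y; rewrite /Ix /I01/= !in_itv/=; lra.
have [K hK] := cauchy_ess_bounded (`|x| + 1) uu0.
have mshift : measurable_fun setT (fun y => L (u + u) (x + y)).
  by apply: measurableT_comp; [exact: mL|exact: measurable_funD].
have ish : mu.-integrable I01 (EFin \o (fun y => L (u + u) (x + y))).
  apply: (@ess_bounded_integrable _ _ 1 K); [exact: mshift| |lra|lra].
  have := lebesgue_affine_ae x ltr01 hK; apply: lebesgue_aeS => y hy y1.
  move: hy; rewrite mul1r addrC; apply.
  by rewrite (le_trans (ler_normD _ _))// lerD2l.
have trans : (\int[mu]_(y in I01) (L (u + u) (x + y))%:E =
    \int[mu]_(z in Ix) (L (u + u) z)%:E)%E.
  have := @integral_translate _ (L (u + u)) x Ix mIx (mL uu0).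
  by rewrite pre; apply.
have iu : mu.-integrable I01 (EFin \o L u) by exact: cauchy_integrable.
have icst : mu.-integrable I01 (EFin \o cst (L u x)).
  apply: (@ess_bounded_integrable _ _ 1 `|L u x|); [by []|by apply: aeW|lra|lra].
have aeE : (\int[mu]_(y in I01) (L (u + u) (x + y))%:E =
    \int[mu]_(y in I01) (L u x + L u y)%:E)%E.
  apply: ae_eq_integral => //.
  - exact: (measurable_int _ ish).
  - apply/measurable_funTS/measurable_EFinP/measurable_funD => //; exact: mL.
  - by move: hx; apply: lebesgue_aeS => y <-.
have : \int[mu]_(y in I01) (L u x + L u y) = \int[mu]_(z in Ix) L (u + u) z.
  by rewrite /Rintegral -aeE trans.
rewrite RintegralD// Rintegral_cst// => <-.
have -> : fine (mu I01) = 1.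
  by rewrite /I01 lebesgue_measure_itv/= lte_fin ltr01 oppr0 adde0.
by rewrite mulr1 addrK.
Qed.

Lemma moving_integral_continuous h :
  (forall a b, mu.-integrable `[a, b] (EFin \o h)) -> continuous (moving_integral h).
Proof.
move=> ih x.
(* A base point below every [y] at distance less than 1 from [x]: the moving integral is then
   [G (y + 1) - G y], with both arguments inside []x - 1, x + 3[]. *)
pose G y := \int[mu]_(t in `[x - 1, y]) h t.
have GE y z : x - 1 <= y -> y <= z -> \int[mu]_(t in `[y, z]) h t = G z - G y.
  move=> xy yz; rewrite /G Rintegral_itvB//.
  rewrite Rintegral_itv_obnd_cbnd//.
  by apply: (integrableS _ _ _ (ih y z)) => //; exact: subset_itv_oc_cc.
have ab : x - 1 < x + 3 by lra.
have cG : {in `]x - 1, x + 3[, continuous G}.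
  have := parameterized_integral_continuous (ltW ab) (ih (x - 1) (x + 3)).
  by move/(continuous_within_itvP _ ab) => [].
have cGx y : x - 1 < y < x + 3 -> {for y, continuous G}.
  by move=> yx; apply: cG; rewrite in_itv.
have c1 : G (y + 1) - G y @[y --> x] --> G (x + 1) - G x.
  apply: cvgB; last by apply: cGx; apply/andP; split; lra.
  apply: (cvg_comp (fun y => y + 1) G).
    by apply: cvgD; [exact: cvg_id|exact: cvg_cst].
  by apply: cGx; apply/andP; split; lra.
have E : moving_integral h x = G (x + 1) - G x by apply: GE; lra.
rewrite /continuous_at E.
apply: cvg_trans c1; apply: near_eq_cvg.
exists 1 => //= y xy; rewrite /moving_integral GE//; last lra.
by move: xy; rewrite /ball/= ltr_norml; lra.
Qed.

Lemma smooth_version_continuous u : 0 < u -> continuous (smooth_version u).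
Proof.
move=> u0 x; apply: cvgB; last exact: cvg_cst.
apply: moving_integral_continuous => a b.
by apply: cauchy_integrable; rewrite addr_gt0.
Qed.

(** The exceptional sets are removed one variable at a time, each by [continuous_ae_eq]: first [y]
    for almost every fixed [x], then [x]. *)
Lemma smooth_version_add u v x y : 0 < u -> 0 < v ->
  smooth_version u x + smooth_version v y = smooth_version (u + v) (x + y).
Proof.
move=> u0 v0; have uv0 : 0 < u + v by rewrite addr_gt0.
have cu := smooth_version_continuous u0.
have cv := smooth_version_continuous v0.
have cuv := smooth_version_continuous uv0.
have cshift a : continuous (fun z => smooth_version (u + v) (a + z)).
  move=> z; apply: (cvg_comp (fun y => a + y) (smooth_version (u + v))).
    by apply: cvgD; [exact: cvg_cst|exact: cvg_id].
  exact: cuv.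
have ae1 : {ae mu, forall x, forall y,
    smooth_version u x + smooth_version v y = smooth_version (u + v) (x + y)}.
  have FF := ae_filter_ringOfSetsType mu.
  have h1 := addL u0 v0; have h2 := smooth_version_ae u0.
  apply: (@filterS2 _ _ FF _ _ _ _ h1 h2) => a ha La b.
  apply: (@continuous_ae_eq _ (fun b => smooth_version u a + smooth_version v b)
    (fun b => smooth_version (u + v) (a + b))) => //.
    by move=> z; apply: cvgD; [exact: cvg_cst|exact: cv].
  have h3 := smooth_version_ae v0.
  have h4 := lebesgue_affine_ae a ltr01 (smooth_version_ae uv0).
  apply: (@filterS3 _ _ FF _ _ _ _ _ ha h3 h4) => z.
  by rewrite mul1r (addrC z) La => hz <- <-.
apply: (@continuous_ae_eq _ (fun x => smooth_version u x + smooth_version v y)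
  (fun x => smooth_version (u + v) (x + y))).
- by move=> z; apply: cvgD; [exact: cu|exact: cvg_cst].
- move=> z; apply: (cvg_comp (fun x => x + y) (smooth_version (u + v))).
    by apply: cvgD; [exact: cvg_id|exact: cvg_cst].
  exact: cuv.
- by move: ae1; apply: lebesgue_aeS => z; apply.
Qed.

Lemma cauchy_half_plane : exists c, forall u, 0 < u ->
  {ae mu, forall x, L u x = c * x - c / 2 * u}.
Proof.
pose l := smooth_version; pose c := l 1 1 - l 1 0; exists c.
have addl u v x y : 0 < u -> 0 < v -> l u x + l v y = l (u + v) (x + y).
  exact: smooth_version_add.
pose m x := l 1 x - l 1 0.
have o1 : 0 < 1 :> R by [].
(* [l (u + 1) x] is computed both as [(u, x) + (1, 0)] and as [(u, 0) + (1, x)], so the dependence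
   on [x] is the same for all [u]. *)
have lm u x : 0 < u -> l u x = l u 0 + m x.
  move=> u0; have := addl u 1 x 0 u0 o1; have := addl u 1 0 x u0 o1.
  by rewrite addr0 add0r /m => <-; lra.
have mlin x : m x = c * x.
  have -> : c = m 1 by [].
  apply: additive_continuous_linear.
    by move=> y; apply: cvgB; [exact: smooth_version_continuous|exact: cvg_cst].
  move=> y z; have := addl 1 1 y z o1 o1; have := addl 1 1 (y + z) 0 o1 o1.
  by rewrite addr0 /m => <-; lra.
move=> u u0; have u40 : 0 < 4 * u by rewrite mulr_gt0.
have uu0 : 0 < u + u by rewrite addr_gt0.
have l4 : l (4 * u) 0 = 4 * l u 0.
  have h1 := addl u u 0 0 u0 u0; have h2 := addl (u + u) (u + u) 0 0 uu0 uu0.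
  have e4 : 4 * u = u + u + (u + u) by ring.
  by rewrite addr0 in h1; rewrite addr0 in h2; rewrite e4 -h2 -h1; ring.
(* At [x = 0] the doubling equation reads [2 * l u 0 = l (4 * u) u = 4 * l u 0 + c * u]. *)
have lu0 : l u 0 = - (c / 2 * u).
  have : 2 * l u 0 = l (4 * u) (2 * 0 + u).
    apply: (@continuous_ae_eq _ (fun x => 2 * l u x) (fun x => l (4 * u) (2 * x + u))).
    - by move=> x; apply: cvgM; [exact: cvg_cst|exact: smooth_version_continuous].
    - move=> x; apply: (cvg_comp (fun x => 2 * x + u) (l (4 * u))).
        apply: cvgD; last exact: cvg_cst.
        by apply: cvgM; [exact: cvg_cst|exact: cvg_id].
      exact: smooth_version_continuous.
    - have FF := ae_filter_ringOfSetsType mu.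
      have two0 : 0 < 2 :> R by [].
      have h4 := lebesgue_affine_ae u two0 (smooth_version_ae u40).
      apply: (@filterS3 _ _ FF _ _ _ _ _ (dblL u0) (smooth_version_ae u0) h4).
      by move=> x h1 h2 h3; rewrite /= /l -h2 -h3.
  by rewrite mulr0 add0r (lm _ u u40) mlin l4; lra.
have := smooth_version_ae u0; apply: lebesgue_aeS => x ->.
by rewrite -/l lm// mlin lu0; ring.
Qed.

End CauchyHalfPlane.

(** * Solutions on the half-plane *)

Section HalfPlaneFunctions.
Context {R : realType}.
Local Notation mu := (@lebesgue_measure R).
Local Notation RR := (measurableTypeR R).
Implicit Types (f g : R -> R -> R) (k u x : R).

Lemma continuous2_cvg f (I : Type) (F : set_system I) {FF : Filter F}
    (s : I -> R * R) (z : R * R) : continuous2 f -> half_plane z ->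
  (forall i, half_plane (s i)) -> s @ F --> z ->
  f (s i).1 (s i).2 @[i --> F] --> f z.1 z.2.
Proof.
move=> /subspace_continuousP cf hz hs sz; have cz := cf z hz.
apply: (cvg_comp s (fun y : R * R => f y.1 y.2) _ cz).
move=> A /= wA; have := sz _ wA; rewrite /nbhs/=.
by apply: filterS => i; apply; exact: hs.
Qed.

Lemma continuous2_section f u : continuous2 f -> 0 <= u -> continuous (f u).
Proof.
move=> cf u0 x; have hz : half_plane (u, x) by [].
have cs : (fun y : R => (u, y)) @ x --> (u, x).
  by apply: (@cvg_pair _ _ _ _ (nbhs u) (nbhs x)); [exact: cvg_cst|exact: cvg_id].
exact: (continuous2_cvg cf hz _ cs).
Qed.

Lemma measurable_half_plane : measurable (@half_plane R).
Proof.
rewrite (_ : half_plane = `[0, +oo[%classic `*` setT).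
  by apply: measurableX => //; exact: measurable_itv.
by apply/seteqP; split=> z; rewrite /half_plane/= in_itv/= andbT // => -[].
Qed.

Lemma measurable2_section f u : measurable2 f -> 0 <= u -> measurable_fun setT (f u).
Proof.
move=> mf u0.
have mp : measurable_fun setT (fun y : R => (u, y)) by exact: measurable_fun_pair.
have mH := measurable_half_plane.
apply: (measurable_comp mH _ mf mp).
by move=> _ [y _ <-].
Qed.

Lemma continuous_exp_fun k u : continuous (exp_fun k u).
Proof.
move=> x; apply: (cvg_comp (fun v => k * v - k / 2 * u) expR); last exact: continuous_expR.
by apply: cvgB; [apply: cvgM; [exact: cvg_cst|exact: cvg_id]|exact: cvg_cst].
Qed.

Lemma continuous2_exp_fun k : continuous2 (exp_fun k).
Proof.
apply: continuous_subspaceT => z.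
apply: (cvg_comp (fun z : R * R => k * z.2 - k / 2 * z.1) expR); last exact: continuous_expR.
by apply: cvgB; apply: cvgM; [exact: cvg_cst|exact: cvg_snd|exact: cvg_cst|exact: cvg_fst].
Qed.

Lemma measurable2_exp_fun k : measurable2 (exp_fun k).
Proof.
apply: measurable_funTS; apply: measurableT_comp; first exact: measurable_expR.
by apply: measurable_funB; apply: measurable_funM.
Qed.

Lemma strictly_positive2_exp_fun k : strictly_positive2 (exp_fun k).
Proof. by move=> u v _; exact: expR_gt0. Qed.

(** Tonelli applied to the exceptional set: its sections are null for [u > 0] and empty for
    [u < 0]. *)
Lemma ae_sections_ae_eq2 f k : measurable2 f ->
  (forall u, 0 < u -> {ae mu, forall x, f u x = exp_fun k u x}) ->
  ae_eq2 f (exp_fun k).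
Proof.
move=> mf fk.
pose D (z : R * R) := f z.1 z.2 - exp_fun k z.1 z.2.
have mD : measurable_fun (@half_plane R) D.
  by apply: measurable_funB => //; exact: measurable2_exp_fun.
pose N : set (RR * RR) := [set z | half_plane z /\ D z <> 0].
have mN : measurable N.
  have mH := measurable_half_plane.
  have : measurable (half_plane `&` D @^-1` [set~ 0]).
    by apply: mD => //; exact: measurableC.
  by [].
exists N; split => //; last first.
  move=> z /= hz; apply: contrapT => nN; apply: hz => hz.
  apply: contrapT => fz; apply: nN; split => // /eqP.
  by rewrite /D subr_eq0 => /eqP.
rewrite /product_measure1.
have mfx : measurable_fun setT (mu \o xsection N) by exact: measurable_fun_xsection.
have : (\int[mu]_x `|(mu \o xsection N) x| = 0)%E.
  apply/(ae_eq_integral_abs mu measurableT mfx).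
  (* Nothing is known of the section at [u = 0], but this is a single value of [u]. *)
  exists [set 0]; split; [exact: measurable_set1|exact: lebesgue_measure_set1|].
  move=> u /= h; apply: contrapT => u0; apply: h => _.
  have mxs : measurable (xsection N u) by exact: measurable_xsection.
  have [ugt|ult|/esym//] := ltrgtP 0 u.
    have [B [mB B0 fB]] := fk u ugt.
    apply/eqP; rewrite -measure_le0 -B0 le_measure ?inE// => y /xsectionP[_ Dz].
    by apply: fB => /= fE; apply: Dz; rewrite /D/= fE subrr.
  rewrite (_ : xsection N u = set0) ?measure0//.
  by apply/seteqP; split => // y /xsectionP[]; rewrite /half_plane/= leNgt ult.
by move=> <-; apply: eq_integral => x _; rewrite gee0_abs.
Qed.

End HalfPlaneFunctions.

(** * From the equation to the equivalences *)

Section Solutions.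
Context {R : realType} {d : measure_display} {T : measurableType d}.
Variables (P : probability T R) (F : R -> set (set T)) (W : R -> T -> R).
Hypotheses (hF : usual_filtration P F) (hW : brownian_motion P F W).
Local Notation mu := (@lebesgue_measure R).
Implicit Type f : R -> R -> R.

(** The equation is tested only on processes having a square characteristic, and these have a
    martingale part, so they belong to [semimartingale0]. *)
Lemma semimartingale_solution V f :
  solution P F (semimartingale0 P F) f -> solution P F V f.
Proof.
move=> solf X Y _ _ QX QY QXY QS hX hY; apply: (solf X Y) => //.
  by have [M pM _] := hX; exists M.
by have [M pM _] := hY; exists M.
Qed.

(** Strict positivity allows taking [ln], which turns the two Brownian equations into the hypotheses
    of [cauchy_half_plane]. *)
Lemma solution_exp_sections f : (forall u, 0 < u -> measurable_fun setT (f u)) ->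
  strictly_positive2 f -> solution P F (indicator_integrals P F W) f ->
  exists k, forall u, 0 < u -> {ae mu, forall x, f u x = exp_fun k u x}.
Proof.
move=> mf pf solf.
have pos u x : 0 < u -> f u x \is Num.pos by move=> u0; rewrite posrE pf// ltW.
have [||| k hk] := @cauchy_half_plane R (fun u x => ln (f u x)).
- by move=> u u0; apply: measurableT_comp; [exact: measurable_ln|exact: mf].
- move=> u v u0 v0; have := solution_ae_multiplicative hF hW solf mf u0 v0.
  apply: lebesgue_aeS => x; apply: lebesgue_aeS => y <-.
  by rewrite lnM ?pos.
- move=> u u0; have := solution_ae_square hF hW solf mf u0.
  apply: lebesgue_aeS => x <-.
  by rewrite lnXn ?pf ?ltW// mulr_natl.
exists k => u u0; have := hk u u0; apply: lebesgue_aeS => x hx.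
by rewrite /exp_fun -hx lnK// pos.
Qed.

Lemma continuous_solution_exp f : continuous2 f -> strictly_positive2 f ->
  solution P F (indicator_integrals P F W) f ->
  exists k, forall u v, 0 <= u -> f u v = exp_fun k u v.
Proof.
move=> cf pf solf.
have mf u : 0 < u -> measurable_fun setT (f u).
  move=> u0; apply: continuous_measurable_fun.
  exact: (continuous2_section cf (ltW u0)).
have [k fk] := solution_exp_sections mf pf solf.
have fpos u v : 0 < u -> f u v = exp_fun k u v.
  move=> u0; apply: continuous_ae_eq; last exact: fk.
    exact: (continuous2_section cf (ltW u0)).
  exact: continuous_exp_fun.
exists k => u v; rewrite le_eqVlt => /predU1P[<-|]; last exact: fpos.
(* The line [u = 0] is approached from inside the half-plane, where the formula is already known. *)
pose s (n : nat) : R * R := (n.+1%:R^-1, v).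
have s0 : s @ \oo --> (0, v).
  by apply: (@cvg_pair _ _ _ _ (nbhs (0 : R)) (nbhs v));
    [exact: cvg_harmonic|exact: cvg_cst].
have hs n : half_plane (s n) by rewrite /half_plane/= invr_ge0.
have h0 : half_plane ((0, v) : R * R) by rewrite /half_plane/=.
have c1 : f (s n).1 (s n).2 @[n --> \oo] --> f 0 v.
  exact: (continuous2_cvg cf h0 hs s0).
have c2 : exp_fun k (s n).1 (s n).2 @[n --> \oo] --> exp_fun k 0 v.
  exact: (continuous2_cvg (@continuous2_exp_fun R k) h0 hs s0).
have e : (fun n => f (s n).1 (s n).2) = (fun n => exp_fun k (s n).1 (s n).2).
  by apply/funext => n; rewrite fpos// invr_gt0.
by rewrite e in c1; apply: (cvg_unique _ c1 c2) => //; exact: Rhausdorff.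
Qed.

End Solutions.

(** The converse in (2) passes to a modification of [f]: windows probe a function along single lines
    where [u] is constant, and such lines are null in the half-plane, so altering [f] on one of them
    preserves [c'] but can destroy the equation. *)
Theorem theorem1 (R : realType) (d : measure_display) (T : measurableType d)
  (P : probability T R) (F : R -> set (set T)) (W : R -> T -> R)
  (hP : measure_is_complete P) (hF : usual_filtration P F)
  (hW : brownian_motion P F W) (f : R -> R -> R) :
  let a := [/\ continuous2 f, strictly_positive2 f &
               solution P F (semimartingale0 P F) f] in
  let b := [/\ continuous2 f, strictly_positive2 f &
               solution P F (indicator_integrals P F W) f] in
  let c := exists k : R, forall u v : R, 0 <= u -> f u v = exp_fun k u v in
  let b' g := [/\ measurable2 g, strictly_positive2 g &
                  solution P F (indicator_integrals P F W) g] in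
  let c' := exists k : R, ae_eq2 f (exp_fun k) in
  ((a <-> b) /\ (b <-> c)) /\
  ((b' f -> c') /\ (c' <-> exists g : R -> R -> R, ae_eq2 f g /\ b' g)).
Proof.
move=> a b c b' c'.
have ab : a -> b by move=> [cf pf sf]; split => //; exact: semimartingale_solution.
have bc : b -> c by move=> [cf pf sf]; exact: continuous_solution_exp cf pf sf.
have ca : c -> a.
  move=> [k fk]; split.
  - apply/subspace_continuousP => z hz.
    have /subspace_continuousP/(_ z hz) ck := @continuous2_exp_fun R k.
    have {ck} : exp_fun k y.1 y.2 @[y --> within half_plane (nbhs z)] -->
      exp_fun k z.1 z.2 := ck.
    rewrite -(fk z.1 z.2 hz); apply: cvg_trans; apply: near_eq_cvg.
    rewrite near_withinE; apply: nearW => y hy.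
    exact/esym/(fk y.1 y.2 hy).
  - by move=> u v u0; rewrite fk// strictly_positive2_exp_fun.
  - exact: exp_fun_solution fk.
(* Stated for an arbitrary [g], since it is applied both to [f] and to a modification of it. *)
have b'c' g : b' g -> exists k, ae_eq2 g (exp_fun k).
  move=> [mg pg sg].
  have mgu u : 0 < u -> measurable_fun setT (g u).
    by move=> u0; apply: measurable2_section => //; exact: ltW.
  have [k gk] := solution_exp_sections hF hW mgu pg sg.
  by exists k; exact: ae_sections_ae_eq2.
split; first by split; split => // h; [exact/ca/bc|exact/ab/ca].
split; first exact: b'c'.
split=> [[k fk]|[g [fg /b'c'[k gk]]]].
  exists (exp_fun k); split => //; split; [exact: measurable2_exp_fun|
    exact: strictly_positive2_exp_fun|exact: (exp_fun_solution hF (k := k))].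
exists k; have ae_filter := ae_filter_ringOfSetsType
  (@lebesgue_measure R \x @lebesgue_measure R)%E.
by apply: (@filterS2 _ _ ae_filter _ _ _ _ fg gk) => z fz gz hz; rewrite fz// gz.
Qed.
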